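(* Assume there are $\mu,\gamma>0$ and an observed $(\mathscr F_k)$-adapted sequence $(\sigma_k)_{k\ge 0}$ of positive random variables such that $$\mathbb E\Big[\exp\Big(\mu\frac{\varepsilon_k^2}{\sigma_{k-1}^2}\Big)\,\Big|\,\mathscr F_{k-1}\Big]\le\gamma\qquad\forall k\ge 1.$$ Let $\hat f(\hat H)$ be the estimator with the bandwidth $\hat H$ selected by Lepski's rule (defined in the context, with parameters $h_0>0$, $q\in(0,1)$, $b>0$, $u_0>0$, $\nu>0$), and let $\bar W$, $H^*$, $\Omega'$ be as defined in the context (with parameters $\delta_0,\alpha_0>0$). Then, for any $\rho\in\big(0,\ b\mu\nu^2/(64\,\alpha_0(1+\gamma))\big)$, $$\mathbb P\Big[\big\{|\hat f(\hat H)-f(x)|\ge t\,\bar W(H^* )\big\}\cap\Omega'\Big]\le C_0\,\frac{(\log(t+1))^{1+\rho/2}}{t^\rho}$$ for any $t\ge t_0$, where $C_0,t_0>0$ are constants depending on $\rho,\mu,\gamma,q,b,u_0,\delta_0,\alpha_0,\nu$.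
   Context: Model. $(X_k)_{k\ge0}$ and $(Y_k)_{k\ge1}$ are sequences of random variables in $\mathbb R^d$ and $\mathbb R$ respectively, adapted to a filtration $(\mathscr F_k)_{k\ge0}$, with $Y_k=f(X_{k-1})+\varepsilon_k$ for all $k\ge1$, where $f:\mathbb R^d\to\mathbb R$ is unknown and $(\varepsilon_k)_{k\ge1}$ is an $(\mathscr F_k)$-martingale increment: $\mathbb E(|\varepsilon_k|\mid\mathscr F_{k-1})<\infty$ and $\mathbb E(\varepsilon_k\mid\mathscr F_{k-1})=0$. The point $x\in\mathbb R^d$ is fixed and $N\ge1$ is a finite $(\mathscr F_k)$-stopping time; one observes $(X_{k-1},Y_k)_{k=1}^N$. $|\cdot|$ is the Euclidean norm. Kernel estimator. For $h>0$, $$L(h)=\sum_{k=1}^N\frac1{\sigma_{k-1}^2}\mathbf 1_{|X_{k-1}-x|\le h},$$ and, if $L(h)>0$, $\hat f(h)=\frac1{L(h)}\sum_{k=1}^N\frac1{\sigma_{k-1}^2}\mathbf 1_{|X_{k-1}-x|\le h}Y_k$. Lepski's rule. Fix $h_0>0$, $q\in(0,1)$, $b>0$, $u_0>0$, $\nu>0$. Let $h_j=h_0q^j$ $(j\ge0)$, $\mathcal H=\{h_j:L(h_j)>0\}$, and $\psi(h)=1+b\log(h_0/h)$. For $u>0$, on the event $\{L(h_0)^{-1/2}\le u\}$, let $H_u=\min\{h\in\mathcal H:(\psi(h)/L(h))^{1/2}\le u\}$. On $\{L(h_0)^{-1/2}\le u_0\}$ define $$\hat H=\max\Big\{h\in\mathcal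 H: h\ge H_{u_0}\text{ and }\forall h'\in[H_{u_0},h]\cap\mathcal H,\ |\hat f(h)-\hat f(h')|\le\nu\Big(\frac{\psi(h')}{L(h')}\Big)^{1/2}\Big\}.$$ Oracle. For $h\in\mathcal H$ let $\tilde f(h)=\frac1{L(h)}\sum_{k=1}^N\frac1{\sigma_{k-1}^2}\mathbf 1_{|X_{k-1}-x|\le h}f(X_{k-1})$. Let $(W(h);h\in\mathcal H)$ be any family of non-negative random variables such that $$\sup_{h'\in[H_{u_0},h]\cap\mathcal H}|\tilde f(h')-f(x)|\le W(h)\qquad\forall h\in\mathcal H.$$ Given constants $\delta_0,\alpha_0>0$, set $\bar W(h)=\big[W(h)\vee(\delta_0(h/h_0)^{\alpha_0})\big]\wedge u_0$. On $\{L(h_0)^{-1/2}\le\bar W(h_0)\}$ set $$H^*=\min\Big\{h\in\mathcal H:\Big(\frac{\psi(h)}{L(h)}\Big)^{1/2}\le\bar W(h)\Big\},$$ and let $\Omega'=\{L(h_0)^{-1/2}\le\bar W(h_0),\ W(H^* )\le u_0\}$. *)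

(* Defs.v *)
From mathcomp Require Import all_boot all_order all_algebra.
From mathcomp Require Import all_classical all_reals all_analysis.
From mathcomp Require Import measurable_realfun.
Set Implicit Arguments.
Unset Strict Implicit.
Unset Printing Implicit Defensive.
Import Order.TTheory GRing.Theory Num.Theory.
Import numFieldNormedType.Exports.
Local Open Scope classical_set_scope.
Local Open Scope ring_scope.

(* The library norm on 'rV[R]_d is the sup norm, hence this definition. *)
Definition enorm {R : realType} {d : nat} (v : 'rV[R]_d) : R :=
  Num.sqrt (\sum_(i < d) v ord0 i ^+ 2).

Definition filtration {disp : measure_display} {T : measurableType disp}
    (F : nat -> set (set T)) : Prop :=
  [/\ forall k, sigma_algebra setT (F k),
      forall k, F k `<=` measurable &
      forall j k, (j <= k)%N -> F j `<=` F k].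

Definition measurable_wrt {T : Type} (G : set (set T))
    {disp : measure_display} {U : measurableType disp} (f : T -> U) : Prop :=
  forall B : set U, measurable B -> G (f @^-1` B).

(* The library has no measurable structure on 'rV[R]_d: the Borel sigma-algebra
   is spelled out. *)
Definition vmeasurable_wrt {T : Type} (G : set (set T))
    {R : realType} {d : nat} (f : T -> 'rV[R]_d) : Prop :=
  forall B : set 'rV[R]_d, <<s [set U : set 'rV[R]_d | open U] >> B ->
    G (f @^-1` B).

Definition stopping_time {T : Type} (F : nat -> set (set T)) (N : T -> nat)
  : Prop := forall n, F n [set w | (N w <= n)%N].

(* [Z] is a version of E(X | G), for X >= 0 that need not be integrable. *)
Definition cond_exp_ge0 {disp : measure_display} {T : measurableType disp}
    {R : realType} (P : probability T R) (G : set (set T))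
    (X Z : T -> \bar R) : Prop :=
  [/\ measurable_wrt G Z,
      forall w, (0 <= Z w)%E &
      forall A, G A -> (\int[P]_(w in A) X w = \int[P]_(w in A) Z w)%E].

(* [Z] is a version of E(X | G) = E(X^+ | G) - E(X^- | G), where
   E(|X| | G) < oo almost surely but X need not be integrable. *)
Definition cond_exp {disp : measure_display} {T : measurableType disp}
    {R : realType} (P : probability T R) (G : set (set T))
    (X Z : T -> R) : Prop :=
  measurable_wrt G Z /\
  exists Zp Zn : T -> \bar R,
    [/\ cond_exp_ge0 P G (fun w => (Num.max (X w) 0)%:E) Zp,
        cond_exp_ge0 P G (fun w => (Num.max (- X w) 0)%:E) Zn,
        {ae P, forall w, (Zp w < +oo)%E /\ (Zn w < +oo)%E} &
        {ae P, forall w, ((Z w)%:E = Zp w - Zn w)%E}].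

Definition martingale_increment {disp : measure_display}
    {T : measurableType disp} {R : realType} (P : probability T R)
    (F : nat -> set (set T)) (eps : nat -> T -> R) : Prop :=
  forall k, (1 <= k)%N ->
    [/\ measurable_wrt (F k) (eps k),
        exists2 Z : T -> \bar R,
          cond_exp_ge0 P (F k.-1) (fun w => `|eps k w|%:E) Z &
          {ae P, forall w, (Z w < +oo)%E} &
        cond_exp P (F k.-1) (eps k) (cst 0)].

Definition sub_gaussian {disp : measure_display}
    {T : measurableType disp} {R : realType} (P : probability T R)
    (F : nat -> set (set T)) (eps sigma : nat -> T -> R) (mu gamma : R)
  : Prop :=
  forall k, (1 <= k)%N ->
    exists2 Z : T -> \bar R,
      cond_exp_ge0 P (F k.-1)
        (fun w => (expR (mu * (eps k w ^+ 2 / sigma k.-1 w ^+ 2)))%:E) Z &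
      {ae P, forall w, (Z w <= gamma%:E)%E}.

Definition kernel_sum {R : realType} {d : nat} {T : Type} (x : 'rV[R]_d)
    (X : nat -> T -> 'rV[R]_d) (sigma : nat -> T -> R) (N : T -> nat)
    (V : nat -> T -> R) (h : R) (w : T) : R :=
  \sum_(1 <= k < (N w).+1)
    (sigma k.-1 w ^+ 2)^-1 * \1_[set z | enorm (z - x) <= h] (X k.-1 w) * V k w.

Definition kernel_weight {R : realType} {d : nat} {T : Type} (x : 'rV[R]_d)
    (X : nat -> T -> 'rV[R]_d) (sigma : nat -> T -> R) (N : T -> nat)
    (h : R) (w : T) : R :=
  \sum_(1 <= k < (N w).+1)
    (sigma k.-1 w ^+ 2)^-1 * \1_[set z | enorm (z - x) <= h] (X k.-1 w).

(* Only meaningful where [kernel_weight x X sigma N h w] is positive. *)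
Definition kernel_mean {R : realType} {d : nat} {T : Type} (x : 'rV[R]_d)
    (X : nat -> T -> 'rV[R]_d) (sigma : nat -> T -> R) (N : T -> nat)
    (V : nat -> T -> R) (h : R) (w : T) : R :=
  (kernel_weight x X sigma N h w)^-1 * kernel_sum x X sigma N V h w.

(* Junk value 0 when the minimum or the maximum does not exist. *)
Definition set_min {R : realType} (A : set R) : R := xget 0 (A `&` lbound A).
Definition set_max {R : realType} (A : set R) : R := xget 0 (A `&` ubound A).

(* From here on everything is at a fixed outcome: [L], [fhat] and [Wbar] are
   functions of the bandwidth only. *)

Definition bandwidths {R : realType} (h0 q : R) (L : R -> R) : set R :=
  [set h | exists2 j : nat, h = h0 * q ^+ j & 0 < L h].

Definition psi {R : realType} (h0 b h : R) : R := 1 + b * ln (h0 / h).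

Definition rate {R : realType} (h0 b : R) (L : R -> R) (h : R) : R :=
  Num.sqrt (psi h0 b h / L h).

(* l^(-1/2) <= u, with 0^(-1/2) = +oo. *)
Definition rsqrt_le {R : realType} (l u : R) : Prop :=
  0 < l /\ (Num.sqrt l)^-1 <= u.

Definition H_ {R : realType} (h0 q b : R) (L : R -> R) (u : R) : R :=
  set_min [set h | bandwidths h0 q L h /\ rate h0 b L h <= u].

Definition hatH {R : realType} (h0 q b u0 nu : R) (L fhat : R -> R) : R :=
  set_max [set h | [/\ bandwidths h0 q L h, H_ h0 q b L u0 <= h &
    forall h', bandwidths h0 q L h' -> H_ h0 q b L u0 <= h' <= h ->
      `|fhat h - fhat h'| <= nu * rate h0 b L h']].

Definition barW {R : realType} (h0 u0 delta0 alpha0 : R) (W : R -> R) (h : R)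
  : R := Num.min (Num.max (W h) (delta0 * (h / h0) `^ alpha0)) u0.

Definition Hstar {R : realType} (h0 q b : R) (L Wbar : R -> R) : R :=
  set_min [set h | bandwidths h0 q L h /\ rate h0 b L h <= Wbar h].

(* Main.v *)
Require Import Defs.
From mathcomp Require Import all_boot all_order all_algebra.
From mathcomp Require Import all_classical all_reals all_analysis.
From mathcomp Require Import measurable_realfun.
From mathcomp Require Import ring lra.
Set Implicit Arguments.
Unset Strict Implicit.
Unset Printing Implicit Defensive.
Import Order.TTheory GRing.Theory Num.Theory.
Import numFieldNormedType.Exports.
Local Open Scope classical_set_scope.
Local Open Scope ring_scope.

(* Put c = (1 + gamma) / mu and let M(h) be the sum of the errors weighted as in
   L(h).  Since e^y <= y + e^(y^2), exp(lam M(h) - c lam^2 L(h)) is a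
   supermartingale in the number of observations, hence has mean at most 1 at N.

   Truncate the rate r(h) = (psi(h) / L(h))^(1/2) below by
   min(delta0 (h / h0)^alpha0, u0) and call R(h) the result.  At the bandwidth
   h0 q^j, R ranges over an interval whose logarithmic length is affine in j;
   tilting by a dyadic grid of exponents lam therefore bounds the probability
   that |M / L| >= s R by O(1 + j) exp(- 3 s^2 psi / (16 c)), which is summable
   in j.

   Suppose that the error is at least t Wbar(H* ).  Either |M / L| >= s R at some
   bandwidth, with s of order (log t)^(1/2): this has probability O(t^(-rho)).
   Or Lepski's rule has rejected a bandwidth Hhat / q <= H* although the bias
   below H* is at most Wbar(H* ) <= r(Hhat) / (1 + 8 / nu); the rejection is
   then due to the noise, |M / L| >= (3 / 8) nu R at some h <= H*, while
   Wbar(H* ) = O(s / t) forces (h / h0)^alpha0 = O(s / t).  The restriction on rho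
   is what makes the sum over these h of order (s / t)^rho. *)

(** * Reciprocals and conditional expectations *)

Lemma measurable_funV d (T : measurableType d) (R : realType) (D : set T)
    (f : T -> R) :
  measurable_fun D f -> measurable_fun D (fun w => (f w)^-1).
Proof.
(* [powR] with exponent -1 is the inverse only on nonnegative reals, hence the square; where [f]
   vanishes both sides are 0. *)
move=> mf; rewrite (_ : (fun _ => _) = fun w => f w * (f w ^+ 2) `^ (-1)).
  apply: measurable_funM => //.
  exact: (measurableT_comp (measurable_powR _) (measurable_funX 2 mf)).
apply/funext => w; rewrite powR_inv1 ?sqr_ge0//.
have [->|f0] := eqVneq (f w) 0; first by rewrite mul0r invr0.
by rewrite expr2 invfM mulrA mulfV// mul1r.
Qed.

Section conditional_expectation.
Context d (T : measurableType d) (R : realType) (P : probability T R).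
Variables (G : set (set T)).
Hypotheses (sG : sigma_algebra setT G) (GT : G `<=` measurable).
Local Notation S := (g_sigma_algebraType G).

Lemma measurable_sub (A : set T) : measurable (A : set S) -> G A.
Proof. by rewrite /measurable /= sigma_algebra_id. Qed.

Lemma sub_measurable (A : set T) : G A -> measurable (A : set S).
Proof. by rewrite /measurable /= sigma_algebra_id. Qed.

Lemma measurable_wrtP d' (U : measurableType d') (f : T -> U) :
  measurable_wrt G f <-> measurable_fun [set: S] f.
Proof.
split=> [mf _ B mB|mf B mB].
  by rewrite setTI; apply: sub_measurable; exact: mf.
by apply: measurable_sub; rewrite -[_ @^-1` _]setTI; exact: mf.
Qed.

Lemma measurable_fun_sub d' (U : measurableType d') (f : T -> U) :
  measurable_fun [set: S] f -> measurable_fun [set: T] f.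
Proof. by move=> mf _ B mB; apply/GT/measurable_sub; exact: mf. Qed.

Local Open Scope ereal_scope.
Import HBNNSimple.

(** Simple functions increase to [g], and monotone convergence moves the limit out of the integral.
    They are built on [S], so their level sets lie in [G], and [X] enters the right-hand side only
    through its integrals over sets of [G]. *)
Lemma integral_weight_lim (g X : T -> \bar R) (mg : measurable_fun [set: S] g) :
  (forall w, 0 <= g w) ->
  measurable_fun [set: T] X -> (forall w, 0 <= X w) ->
  let h := nnsfun_approx (@measurableT _ S) mg in
  \int[P]_w (g w * X w) =
    limn (fun n => \sum_(y \in range (h n))
       y%:E * \int[P]_(w in h n @^-1` [set y]) X w).
Proof.
move=> g0 mX X0 h.
have mh n : measurable_fun [set: T] (h n) by exact/measurable_fun_sub.
have nd_h w a b : (a <= b)%N -> ((h a w)%:E <= (h b w)%:E).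
  move=> ab; rewrite lee_fin.
  by have /lefP := nd_nnsfun_approx measurableT mg ab; exact.
have gX w : g w * X w = limn (fun n => (h n w)%:E * X w).
  apply/esym/cvg_lim => //.
  have hg : (h n w)%:E @[n --> \oo] --> g w.
    by apply: cvg_nnsfun_approx => //.
  have [->|X_neq0] := eqVneq (X w) 0.
    by rewrite mule0; under eq_fun do rewrite mule0; exact: cvg_cst.
  have := X0 w; case: (X w) X_neq0 => [r r0 _||]//.
    by apply: cvgeZr => //.
  (* Here [X w] is infinite: the products are all 0 if [g w] is 0, and eventually infinite
     otherwise. *)
  move=> _ _.
  have [gw0|gw0] := eqVneq (g w) 0.
    rewrite gw0 mul0e (_ : (fun _ => _) = cst 0); first exact: cvg_cst.
    apply/funext => n /=; suff -> : h n w = 0%R by rewrite mul0e.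
    have : (h n w)%:E <= g w by rewrite /h nnsfun_approxE; exact: le_approx.
    by rewrite gw0 lee_fin => hn; apply/eqP; rewrite eq_le hn fun_ge0.
  have gw : 0 < g w by rewrite lt0e gw0 g0.
  rewrite gt0_muley//.
  have : \forall n \near \oo, (0 < (h n w)%:E) by exact: (hg _ (open_ereal_gt' gw)).
  move=> hn; apply: cvg_near_cst.
  by apply: filterS hn => n hn /=; rewrite gt0_muley.
under eq_integral => w _ do rewrite gX.
rewrite (@monotone_convergence _ _ _ P setT measurableT
  (fun n w => (h n w)%:E * X w)); last 3 first.
- move=> n; apply: emeasurable_funM => //; exact/measurable_EFinP.
- by move=> n w _; rewrite mule_ge0// lee_fin.
- by move=> w _ a b ab; rewrite lee_wpmul2r ?nd_h.
congr (limn _); apply/funext => n.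
have mhy y : measurable (h n @^-1` [set y] : set T).
  by rewrite -[_ @^-1` _]setTI; exact: mh.
transitivity (\int[P]_w (\sum_(y \in range (h n))
    (y * \1_(h n @^-1` [set y]) w)%:E * X w)).
  apply: eq_integral => w _.
  rewrite -ge0_mule_fsuml; last by move=> y; exact: nnfun_muleindic_ge0.
  by rewrite fsumEFin// -fimfunE.
rewrite ge0_integral_fsum//; last 2 first.
- move=> y; apply: emeasurable_funM => //; apply/measurable_EFinP.
  by apply: measurable_funM => //; exact: measurable_indic.
- by move=> y w _; rewrite mule_ge0//; exact: nnfun_muleindic_ge0.
apply: eq_fsbigr => y; rewrite inE => -[w0 _ yE].
have y0 : (0 <= y)%R by rewrite -yE.
under eq_integral do rewrite EFinM -muleA.
rewrite ge0_integralZl//; last 2 first.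
- apply: emeasurable_funM => //; apply/measurable_EFinP.
  exact: measurable_indic.
- by move=> w _; rewrite mule_ge0// lee_fin.
congr (_ * _); rewrite [RHS]integral_mkcond; apply: eq_integral => w _.
rewrite muleC; exact: (congr1 (fun f => f w) (esym (epatch_indic X _))).
Qed.

(** [X] and [Z] have the same integrals over sets of [G], hence the same limit in
    [integral_weight_lim]. *)
Lemma cond_exp_ge0_mul (g X Z : T -> \bar R) :
  measurable_fun [set: T] X -> (forall w, 0 <= X w) ->
  cond_exp_ge0 P G X Z ->
  measurable_wrt G g -> (forall w, 0 <= g w) ->
  \int[P]_w (g w * X w) = \int[P]_w (g w * Z w).
Proof.
move=> mX X0 [/measurable_wrtP mZ Z0 XZ] /measurable_wrtP mg g0.
rewrite !(integral_weight_lim mg)//; last exact: measurable_fun_sub.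
congr (limn _); apply/funext => n; apply: eq_fsbigr => y _.
congr (_ * _); apply: XZ; apply: measurable_sub.
by rewrite -[_ @^-1` _]setTI; exact: measurable_funP.
Qed.

End conditional_expectation.

(** * Elementary bounds on the exponential *)

Section exponential_inequalities.
Context (R : realType).
Implicit Types x y z v theta gamma lam mu : R.

Lemma expR_le_inv x : x < 1 -> expR x <= (1 - x)^-1.
Proof.
move=> x1; rewrite -[x]opprK expRN opprK lef_pV2 ?posrE ?expR_gt0 ?subr_gt0//.
by have := expR_ge1Dx (- x).
Qed.

(** For y < 0, e^y <= 1 / (1 - y) <= 1 + y + y^2; for y >= 1, y <= y^2. In between, write e^y =
    e^(y^2) e^(y - y^2), bound both factors by e^x <= 1 / (1 - x), and conclude with (1 + y)(1 - y +
    y^2) = 1 + y^3 >= 1. *)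
Lemma expR_le_add_expR_sqr y : expR y <= y + expR (y ^+ 2).
Proof.
have [y0|y0] := ltP y 0.
  have y1 : 0 < 1 - y by lra.
  apply: (@le_trans _ _ (1 - y)^-1); first by apply: expR_le_inv; lra.
  have := expR_ge1Dx (y ^+ 2) => h.
  apply: (@le_trans _ _ (1 + y + y ^+ 2)); last by lra.
  rewrite -div1r ler_pdivrMr//.
  have : 0 <= (- y) ^+ 3 by rewrite exprn_ge0//; lra.
  rewrite (_ : (- y) ^+ 3 = - y ^+ 3); last by ring.
  by rewrite !exprS expr0; nra.
have [y1|y1] := leP 1 y.
  by rewrite (@le_trans _ _ (expR (y ^+ 2)))// ?lerDr// ler_expR; nra.
have yy1 : y ^+ 2 < 1 by nra.
have z1 : 0 < 1 - (y - y ^+ 2) by nra.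
have -> : expR y = expR (y ^+ 2) * expR (y - y ^+ 2).
  by rewrite -expRD; congr expR; ring.
have e0 := expR_gt0 (y ^+ 2).
apply: (@le_trans _ _ (expR (y ^+ 2) * (1 - (y - y ^+ 2))^-1)).
  by rewrite ler_wpM2l ?(ltW e0)// expR_le_inv//; nra.
rewrite ler_pdivrMr//.
have [->|y_neq0] := eqVneq y 0; first by nra.
have h : expR (y ^+ 2) * (1 - y ^+ 2) <= 1.
  by rewrite -ler_pdivlMr ?subr_gt0// div1r expR_le_inv.
suff : expR (y ^+ 2) * (1 - y) <= 1 - y + y ^+ 2 by nra.
have -> : 1 - y = (1 - y ^+ 2) / (1 + y) by field; lra.
rewrite mulrA ler_pdivrMr; last by lra.
apply: (le_trans h).
have -> : (1 - y ^+ 2) / (1 + y) = 1 - y by field; lra.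
have : 0 <= y ^+ 3 by rewrite exprn_ge0.
by rewrite !exprS expr0; nra.
Qed.

(** Convexity: the tangent at theta v lies below the exponential at 0 and at v; the two inequalities
    are averaged with weights 1 - theta and theta. *)
Lemma expR_chord theta v : 0 <= theta <= 1 ->
  expR (theta * v) <= 1 - theta + theta * expR v.
Proof.
move=> t01.
have e0 := expR_gt0 (theta * v).
have h0 : expR (theta * v) * (1 - theta * v) <= 1.
  rewrite -[leRHS](expRxMexpNx_1 (theta * v)) ler_pM2l//.
  by have := expR_ge1Dx (- (theta * v)).
have h1 : expR (theta * v) * (1 + (v - theta * v)) <= expR v.
  rewrite [leRHS](_ : _ = expR (theta * v) * expR (v - theta * v)).
    by rewrite ler_pM2l// expR_ge1Dx.
  by rewrite -expRD; congr expR; ring.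
nra.
Qed.

(* Coefficients of the majorant in [expR_le_mgf]: for theta <= 1 it comes from
   convexity and keeps the centered linear term, for theta > 1 from AM-GM. *)
Definition mgf_const theta : R := if theta <= 1 then 1 - theta else 0.
Definition mgf_slope theta : R :=
  if theta <= 1 then theta else expR (theta / 4).

Lemma mgf_const_ge0 theta : 0 <= mgf_const theta.
Proof. by rewrite /mgf_const; case: ifP => // t1; rewrite subr_ge0. Qed.

Lemma mgf_slope_ge0 theta : 0 <= theta -> 0 <= mgf_slope theta.
Proof. by rewrite /mgf_slope; case: ifP => // _ _; exact: expR_ge0. Qed.

(** With [gamma] bounding the conditional mean of e^v, this controls the mean of the majorant in
    [expR_le_mgf]; the factor 1 + gamma of the variance constant comes from here. For theta > 1, use
    gamma <= e^gamma and theta / 4 + gamma <= (1 + gamma) theta. *)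
Lemma mgf_le gamma theta : 0 <= gamma -> 0 <= theta ->
  mgf_const theta + mgf_slope theta * gamma <= expR ((1 + gamma) * theta).
Proof.
move=> g0 t0; rewrite /mgf_const /mgf_slope; case: (leP theta 1) => t1.
  by apply: (le_trans _ (expR_ge1Dx _)); nra.
rewrite add0r (@le_trans _ _ (expR (theta / 4) * expR gamma))//.
  rewrite ler_wpM2l ?expR_ge0//.
  by apply: (le_trans _ (expR_ge1Dx _)); lra.
by rewrite -expRD ler_expR; nra.
Qed.

End exponential_inequalities.

(** * Pointwise majorant for a single observation *)

Section sub_gaussian_pointwise.
Context (R : realType) (lam mu s a e : R).
Hypotheses (lam0 : 0 <= lam) (mu0 : 0 < mu) (s0 : 0 < s) (a0 : 0 <= a).
Hypothesis as1 : a * s ^+ 2 <= 1.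
Let theta := lam ^+ 2 * a / mu.
Let v := mu * (e ^+ 2 / s ^+ 2).

Let theta0 : 0 <= theta.
Proof. by rewrite /theta divr_ge0 ?(ltW mu0)// mulr_ge0// sqr_ge0. Qed.

Let ae2 : a * e ^+ 2 <= e ^+ 2 / s ^+ 2.
Proof.
have s2 : 0 < s ^+ 2 by rewrite exprn_gt0.
by rewrite ler_pdivlMr// mulrAC ler_piMl// sqr_ge0.
Qed.

Let sqr_le : (lam * a * e) ^+ 2 <= theta * v.
Proof.
have -> : (lam * a * e) ^+ 2 = theta * mu * (a * e ^+ 2).
  by rewrite /theta; field; rewrite gt_eqF.
by rewrite /v [leRHS]mulrA ler_wpM2l// mulr_ge0// ltW.
Qed.

(** Coefficient of the centered error, which contributes nothing to the mean. It is cut to 0 for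
    theta > 1, where AM-GM leaves no linear term. *)
Definition mgf_lin : R := if lam ^+ 2 * a / mu <= 1 then lam * a else 0.

Lemma mgf_lin_ge0 : 0 <= mgf_lin.
Proof. by rewrite /mgf_lin; case: ifP => // _; exact: mulr_ge0. Qed.

(** For theta <= 1, put y = lam a e in e^y <= y + e^(y^2); since a s^2 <= 1, y^2 <= theta v, and the
    chord bound applies. For theta > 1, theta / 4 + mu a e^2 - lam a e is (a / mu) (lam / 2 - mu
    e)^2, and mu a e^2 <= v. *)
Lemma expR_le_mgf :
  expR (lam * a * e) <= mgf_lin * e + mgf_const theta
    + mgf_slope theta * expR v.
Proof.
rewrite /mgf_lin -/theta /mgf_const /mgf_slope; case: (leP theta 1) => t1.
  apply: le_trans (expR_le_add_expR_sqr _) _.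
  rewrite -!addrA lerD2l addrA; apply: (le_trans _ (expR_chord _ _)) => //.
    by rewrite ler_expR.
  by rewrite theta0.
rewrite mul0r !add0r -expRD ler_expR.
have /(le_trans _) : theta / 4 + mu * (a * e ^+ 2) <= theta / 4 + v.
  by rewrite lerD2l /v ler_wpM2l// ltW.
apply; rewrite -subr_ge0.
have -> : theta / 4 + mu * (a * e ^+ 2) - lam * a * e =
    a / mu * (lam / 2 - mu * e) ^+ 2 by rewrite /theta; field; rewrite gt_eqF.
by rewrite mulr_ge0 ?sqr_ge0// divr_ge0// ltW.
Qed.

(** Gives the linear term a finite integral, so that its positive and negative parts can be
    cancelled in [supermartingale_step]. *)
Lemma mgf_lin_le : mgf_lin * `|e| <= expR v.
Proof.
have v0 : 0 <= v by rewrite /v mulr_ge0 ?(ltW mu0)// divr_ge0 ?sqr_ge0.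
rewrite /mgf_lin -/theta; case: (leP theta 1) => t1; last by rewrite mul0r expR_ge0.
have h : (lam * a * `|e|) ^+ 2 <= v.
  rewrite exprMn real_normK ?num_real// -exprMn (le_trans sqr_le)//.
  by rewrite ler_piMl.
by apply: (le_trans _ (expR_ge1Dx _)); nra.
Qed.

End sub_gaussian_pointwise.

(** * One step of the exponential supermartingale *)

Section one_step.
Context d (T : measurableType d) (R : realType) (P : probability T R).
Variables (G : set (set T)).
Hypotheses (sG : sigma_algebra setT G) (GT : G `<=` measurable).
Local Notation S := (g_sigma_algebraType G).
Variables (mu gamma : R) (e s : T -> R).
Hypotheses (mu0 : 0 < mu) (gamma0 : 0 < gamma).
Hypotheses (me : measurable_fun [set: T] e) (ms : measurable_wrt G s).
Hypothesis s0 : forall w, 0 < s w.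

(** E(e | G) = 0 in integrated form. Both sides may be infinite, so the positive and negative parts
    are kept apart. *)
Definition centered_wrt := forall g : T -> R, measurable_wrt G g ->
  (forall w, 0 <= g w) ->
  (\int[P]_w (g w * Num.max (e w) 0)%:E =
   \int[P]_w (g w * Num.max (- e w) 0)%:E)%E.

Definition exp_sqr_le_wrt := forall g : T -> R, measurable_wrt G g ->
  (forall w, 0 <= g w) ->
  (\int[P]_w (g w * expR (mu * (e w ^+ 2 / s w ^+ 2)))%:E <=
   gamma%:E * \int[P]_w (g w)%:E)%E.

Lemma measurable_mgf_const (f : T -> R) : measurable_fun [set: S] f ->
  measurable_fun [set: S] (fun w => mgf_const (f w)).
Proof.
move=> mf; apply: measurable_fun_ifT => //.
- exact: measurable_fun_ler.
- exact: measurable_funB.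
Qed.

Lemma measurable_mgf_slope (f : T -> R) : measurable_fun [set: S] f ->
  measurable_fun [set: S] (fun w => mgf_slope (f w)).
Proof.
move=> mf; apply: measurable_fun_ifT => //.
- exact: measurable_fun_ler.
- by apply: measurableT_comp => //; exact: measurable_funM.
Qed.

Lemma measurable_mgf_lin (lam : R) (a : T -> R) :
  measurable_fun [set: S] a ->
  measurable_fun [set: S] (fun w => mgf_lin lam mu (a w)).
Proof.
move=> ma; apply: measurable_fun_ifT => //.
- apply: measurable_fun_ler => //.
  by apply: measurable_funM => //; exact: measurable_funM.
- exact: measurable_funM.
Qed.

(** The majorant of [expR_le_mgf] is integrated against a discounted weight: the linear term has
    mean zero, and by [mgf_le] the discount absorbs the rest. *)
Lemma supermartingale_step (lam : R) (a g : T -> R) :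
  0 <= lam -> measurable_wrt G a -> (forall w, 0 <= a w) ->
  (forall w, a w * s w ^+ 2 <= 1) ->
  measurable_wrt G g -> (forall w, 0 <= g w) ->
  (\int[P]_w (g w)%:E < +oo)%E ->
  centered_wrt -> exp_sqr_le_wrt ->
  (\int[P]_w (g w *
     expR (lam * a w * e w - (1 + gamma) / mu * lam ^+ 2 * a w))%:E <=
   \int[P]_w (g w)%:E)%E.
Proof.
move=> lam0 /(measurable_wrtP sG) ma a0 as1 /(measurable_wrtP sG) mg g0 goo He HV.
have Sma := measurable_fun_sub sG GT ma.
have Smg := measurable_fun_sub sG GT mg.
move: ms => /(measurable_wrtP sG) mms.
have Sms := measurable_fun_sub sG GT mms.
pose th w := lam ^+ 2 * a w / mu.
have mth : measurable_fun [set: S] th.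
  by apply: measurable_funM => //; exact: measurable_funM.
have th0 w : 0 <= th w by rewrite /th divr_ge0 ?(ltW mu0)// mulr_ge0// sqr_ge0.
pose V w := expR (mu * (e w ^+ 2 / s w ^+ 2)).
have mV : measurable_fun [set: T] V.
  apply: measurableT_comp => //; apply: measurable_funM => //.
  apply: measurable_funM => //; first exact: measurable_funX.
  by apply: measurable_funV; exact: measurable_funX.
(* The compensator (1 + gamma) / mu * lam^2 * a equals (1 + gamma) * th and moves into the weight,
   which remains [G]-measurable and below [g]. *)
pose g1 w := g w * expR (- ((1 + gamma) * th w)).
have mg1 : measurable_fun [set: S] g1.
  apply: measurable_funM => //; apply: measurableT_comp => //.
  by apply: measurable_funN; exact: measurable_funM.
have g10 w : 0 <= g1 w by rewrite mulr_ge0// expR_ge0.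
have g1g w : g1 w <= g w.
  by rewrite ler_piMr// expR_le1 oppr_le0 mulr_ge0// addr_ge0// ltW.
pose A0 w := mgf_lin lam mu (a w).
pose A1 w := mgf_const (th w).
pose A2 w := mgf_slope (th w).
have mA0 : measurable_fun [set: S] A0 by exact: measurable_mgf_lin.
have mA1 : measurable_fun [set: S] A1 by exact: measurable_mgf_const.
have mA2 : measurable_fun [set: S] A2 by exact: measurable_mgf_slope.
have A00 w : 0 <= A0 w by exact: mgf_lin_ge0.
have A10 w : 0 <= A1 w by exact: mgf_const_ge0.
have A20 w : 0 <= A2 w by exact: mgf_slope_ge0.
pose ep w := Num.max (e w) 0.
pose en w := Num.max (- e w) 0.
have ep0 w : 0 <= ep w by rewrite le_max lexx orbT.
have en0 w : 0 <= en w by rewrite le_max lexx orbT.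
have mep : measurable_fun [set: T] ep by exact: measurable_maxr.
have men : measurable_fun [set: T] en.
  by apply: measurable_maxr => //; exact: measurable_funN.
have epn w : e w = ep w - en w.
  by rewrite /ep /en; case: (leP (e w) 0); case: (leP (- e w) 0); lra.
have sub (f : T -> R) : measurable_fun [set: S] f -> measurable_fun [set: T] f.
  exact: (measurable_fun_sub sG GT).
have mgA0 : measurable_fun [set: S] (fun w => g1 w * A0 w) by exact: measurable_funM.
have EN : (\int[P]_w (g1 w * A0 w * en w)%:E < +oo)%E.
  apply: (@le_lt_trans _ _ (\int[P]_w (g w * V w)%:E)%E).
    apply: ge0_le_integral => //.
    - by move=> w _; rewrite lee_fin !mulr_ge0.
    - by apply/measurable_EFinP; apply: measurable_funM => //; exact: sub.
    - by apply/measurable_EFinP; exact: measurable_funM.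
    - move=> w _; rewrite lee_fin -mulrA ler_pM//; first exact: mulr_ge0.
      apply: (@le_trans _ _ (A0 w * `|e w|)); last exact: mgf_lin_le.
      rewrite ler_wpM2l// /en ge_max normr_ge0 andbT.
      by rewrite -normrN ler_norm.
  apply: (@le_lt_trans _ _ (gamma%:E * \int[P]_w (g w)%:E)%E).
    by apply: HV => //; apply/(measurable_wrtP sG).
  by rewrite lte_mul_pinfty// ?lee_fin ?(ltW gamma0).
(* The negative part of the linear term goes to the left, so that all integrands are nonnegative;
   [EN] allows its cancellation afterwards. *)
have key : (\int[P]_w (g1 w * expR (lam * a w * e w))%:E +
    \int[P]_w (g1 w * A0 w * en w)%:E <=
    \int[P]_w (g1 w * A0 w * ep w)%:E +
    (\int[P]_w (g1 w * A1 w)%:E + \int[P]_w (g1 w * A2 w * V w)%:E))%E.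
  have m1 : measurable_fun [set: T] (fun w => g1 w * expR (lam * a w * e w)).
    apply: measurable_funM; first exact: sub.
    apply: measurableT_comp => //; apply: measurable_funM => //.
    exact: measurable_funM.
  have m2 : measurable_fun [set: T] (fun w => g1 w * A0 w * en w).
    by apply: measurable_funM => //; exact: sub.
  have m3 : measurable_fun [set: T] (fun w => g1 w * A0 w * ep w).
    by apply: measurable_funM => //; exact: sub.
  have m4 : measurable_fun [set: T] (fun w => g1 w * A1 w).
    by apply: sub; exact: measurable_funM.
  have m5 : measurable_fun [set: T] (fun w => g1 w * A2 w * V w).
    by apply: measurable_funM => //; apply: sub; exact: measurable_funM.
  have V0 w : 0 <= V w by exact: expR_ge0.
  rewrite -!ge0_integralD//; try (by apply/measurable_EFinP);
    try (by move=> w _; rewrite lee_fin !mulr_ge0 ?expR_ge0);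
    try (by apply: emeasurable_funD; apply/measurable_EFinP);
    try (by move=> w _; rewrite adde_ge0 ?lee_fin ?mulr_ge0).
  apply: ge0_le_integral => //.
  - by move=> w _; rewrite adde_ge0 ?lee_fin ?mulr_ge0 ?expR_ge0.
  - by apply: emeasurable_funD; apply/measurable_EFinP.
  - by do 2?apply: emeasurable_funD; apply/measurable_EFinP.
  - move=> w _; rewrite -!EFinD lee_fin -!mulrA -!mulrDr !ler_wpM2l ?expR_ge0//.
    have := expR_le_mgf lam (e w) mu0 (s0 w) (a0 w) (as1 w).
    rewrite -/(A0 w) -/(th w) -/(A1 w) -/(A2 w) -/(V w).
    have -> : A0 w * e w = A0 w * ep w - A0 w * en w by rewrite {1}epn mulrBr.
    by rewrite -[lam * a w * e w]mulrA; lra.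
have EE : (\int[P]_w (g1 w * A0 w * en w)%:E = \int[P]_w (g1 w * A0 w * ep w)%:E)%E.
  apply/esym/He; first exact/(measurable_wrtP sG).
  by move=> w; rewrite mulr_ge0.
rewrite EE in EN key.
have -> : (\int[P]_w (g w * expR (lam * a w * e w -
      (1 + gamma) / mu * lam ^+ 2 * a w))%:E
   = \int[P]_w (g1 w * expR (lam * a w * e w))%:E)%E.
  apply: eq_integral => w _; congr (_%:E).
  rewrite /g1 -[RHS]mulrA -expRD; congr (_ * expR _).
  by rewrite /th; field; rewrite gt_eqF.
move: key; rewrite addeC leeD2lE; last first.
  by rewrite ge0_fin_numE// integral_ge0// => w _; rewrite lee_fin !mulr_ge0.
move=> /le_trans; apply.
have mgA2 : measurable_fun [set: S] (fun w => g1 w * A2 w) by exact: measurable_funM.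
apply: (@le_trans _ _ (\int[P]_w (g1 w * A1 w)%:E +
    gamma%:E * \int[P]_w (g1 w * A2 w)%:E)%E).
  rewrite leeD2l//; apply: HV; first exact/(measurable_wrtP sG).
  by move=> w; rewrite mulr_ge0.
rewrite -ge0_integralZl//; last 3 first.
- by apply/measurable_EFinP; exact: sub.
- by move=> w _; rewrite lee_fin mulr_ge0.
- by rewrite lee_fin ltW.
rewrite -ge0_integralD//; last 4 first.
- by move=> w _; rewrite lee_fin mulr_ge0.
- by apply/measurable_EFinP/sub; exact: measurable_funM.
- by move=> w _; rewrite mule_ge0 ?lee_fin ?(ltW gamma0)// mulr_ge0.
- by apply: emeasurable_funM => //; apply/measurable_EFinP; exact: sub.
apply: ge0_le_integral => //.
- by move=> w _; rewrite adde_ge0 ?mule_ge0 ?lee_fin ?(ltW gamma0) ?mulr_ge0.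
- apply: emeasurable_funD.
    by apply/measurable_EFinP/sub; exact: measurable_funM.
  by apply: emeasurable_funM => //; apply/measurable_EFinP; exact: sub.
- exact/measurable_EFinP.
- move=> w _; rewrite -EFinM -EFinD lee_fin.
  have -> : g1 w * A1 w + gamma * (g1 w * A2 w) =
      g w * (expR (- ((1 + gamma) * th w)) * (A1 w + A2 w * gamma)).
    by rewrite /g1; ring.
  rewrite ler_piMr// expRN mulrC ler_pdivrMr ?expR_gt0// mul1r.
  exact: mgf_le (ltW gamma0) (th0 w).
Qed.

End one_step.

(** * Stopping times and the stopped exponential supermartingale *)

Section random_time.
Context d (T : measurableType d) (R : realType) (N : T -> nat).
Hypothesis mN : forall n, measurable [set w | (N w <= n)%N].

Lemma measurable_eq_time n : measurable [set w | N w = n].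
Proof.
case: n => [|n].
  rewrite (_ : [set _ | _] = [set w | (N w <= 0)%N])//.
  by apply/seteqP; split=> w /=; rewrite leqn0 => /eqP.
rewrite (_ : [set _ | _] = [set w | (N w <= n.+1)%N] `\` [set w | (N w <= n)%N]).
  exact: measurableD.
apply/seteqP; split=> w /=; first by move=> ->; split=> //; rewrite ltnn.
by move=> [h1 /negP]; rewrite -ltnNge => h2; apply/eqP; rewrite eqn_leq h1.
Qed.

Lemma measurable_fun_at_time d' (U : measurableType d') (g : nat -> T -> U) :
  (forall n, measurable_fun [set: T] (g n)) ->
  measurable_fun [set: T] (fun w => g (N w) w).
Proof.
move=> mg _ B mB; rewrite setTI.
rewrite (_ : _ @^-1` B = \bigcup_n ([set w | N w = n] `&` g n @^-1` B)).
  apply: bigcupT_measurable => n; apply: measurableI.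
    exact: measurable_eq_time.
  by rewrite -[_ @^-1` _]setTI; exact: mg.
apply/seteqP; split=> w /=; first by move=> Bw; exists (N w).
by move=> [n _ [/= <-]].
Qed.

End random_time.

Section stopped_martingale.
Context d (T : measurableType d) (R : realType) (P : probability T R).
Variables (F : nat -> set (set T)).
Hypothesis fF : filtration F.
Variables (mu gamma : R) (e s : nat -> T -> R).
Hypotheses (mu0 : 0 < mu) (gamma0 : 0 < gamma).
Hypothesis me : forall k, measurable_wrt (F k.+1) (e k).
Hypothesis ms : forall k, measurable_wrt (F k) (s k).
Hypothesis s0 : forall k w, 0 < s k w.
Hypothesis ce : forall k, centered_wrt P (F k) (e k).
Hypothesis ve : forall k, exp_sqr_le_wrt P (F k) mu gamma (e k) (s k).

Let sF k : sigma_algebra setT (F k). Proof. by case: fF. Qed.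
Let FT k : F k `<=` measurable. Proof. by case: fF. Qed.

Let sub d' (U : measurableType d') k (f : T -> U) :
  measurable_wrt (F k) f -> measurable_fun [set: T] f.
Proof.
by move/(measurable_wrtP (sF k)); exact: (measurable_fun_sub (sF k) (@FT k)).
Qed.

(** Indices start at 0: the error [e k] is revealed at time k + 1, while the weights [a k] to be
    inserted are known at time k. *)
Definition exp_martingale (lam : R) (a : nat -> T -> R) n w :=
  expR (\sum_(0 <= k < n)
    (lam * a k w * e k w - (1 + gamma) / mu * lam ^+ 2 * a k w)).

Lemma measurable_exp_martingale (lam : R) (a : nat -> T -> R) :
  (forall k, measurable_wrt (F k) (a k)) ->
  forall n, measurable_wrt (F n) (exp_martingale lam a n).
Proof.
move=> ma n; apply/(measurable_wrtP (sF n)).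
apply: measurableT_comp => //.
have mono k (f : T -> R) : (k <= n)%N -> measurable_wrt (F k) f ->
    measurable_fun [set: g_sigma_algebraType (F n)] f.
  move=> kn mf; apply/(measurable_wrtP (sF n)) => B mB.
  by case: fF => _ _ mon; apply: (mon _ _ kn); exact: mf.
rewrite (_ : (fun _ => _) = (fun w => \sum_(k < n)
    (lam * a k w * e k w - (1 + gamma) / mu * lam ^+ 2 * a k w))); last first.
  by apply/funext => w; rewrite big_mkord.
apply: measurable_sum => k.
have mak := mono _ _ (ltnW (ltn_ord k)) (ma k).
have mek := mono _ _ (ltn_ord k) (me k).
apply: measurable_funB; first by do 2?apply: measurable_funM.
exact: measurable_funM.
Qed.

(** Induction on [n], with the process at time [n] as the weight [g] of [supermartingale_step]; the
    induction hypothesis also makes that weight integrable. *)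
Lemma integral_exp_martingale_le1 (lam : R) (a : nat -> T -> R) : 0 <= lam ->
  (forall k, measurable_wrt (F k) (a k)) -> (forall k w, 0 <= a k w) ->
  (forall k w, a k w * s k w ^+ 2 <= 1) ->
  forall n, (\int[P]_w (exp_martingale lam a n w)%:E <= 1)%E.
Proof.
move=> lam0 ma a0 as1; elim=> [|n IH].
  rewrite /exp_martingale; under eq_integral do rewrite big_geq// expR0.
  by rewrite integral_cst// mul1e; exact: probability_le1.
apply: (le_trans _ IH).
rewrite /exp_martingale; under eq_integral do rewrite big_nat_recr//= expRD.
apply: (supermartingale_step (sF n) (@FT n) mu0 gamma0 (sub (me n)) (ms n)) => //.
- exact: measurable_exp_martingale.
- by apply: (le_lt_trans IH); rewrite ltry.
Qed.

Variable N : T -> nat.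
Hypothesis stN : stopping_time F N.

Let mN n : measurable [set w | (N w <= n)%N].
Proof. exact/FT/stN. Qed.

Variable a : nat -> T -> R.
Hypothesis ma : forall k, measurable_wrt (F k) (a k).
Hypothesis a0 : forall k w, 0 <= a k w.
Hypothesis as1 : forall k w, a k w * s k w ^+ 2 <= 1.

Definition stopped_sum (V : nat -> T -> R) w := \sum_(0 <= k < N w) V k w.

Lemma measurable_stopped_sum V : (forall k, measurable_fun [set: T] (V k)) ->
  measurable_fun [set: T] (stopped_sum V).
Proof.
move=> mV; apply: (measurable_fun_at_time mN (g := fun n w => \sum_(0 <= k < n) V k w)) => n.
by under eq_fun do rewrite big_mkord; exact: measurable_sum.
Qed.

(** Weights switched off from time [N] on. The event k < N is the complement of N <= k, so they are
    still known at time k, and the process with these weights is constant after [N]. *)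
Let ak k w := a k w * (k < N w)%N%:R.

Let mak k : measurable_wrt (F k) (ak k).
Proof.
apply/(measurable_wrtP (sF k)); apply: measurable_funM.
  by apply/(measurable_wrtP (sF k)).
rewrite (_ : (fun _ => _) = \1_(~` [set w | (N w <= k)%N])); last first.
  apply/funext => w; rewrite indicE; congr (_%:R); congr nat_of_bool.
  apply/idP/idP => [h|]; first by rewrite inE /=; apply/negP; rewrite -ltnNge.
  by rewrite inE /= => /negP; rewrite -ltnNge.
apply: measurable_indic; apply: measurableC.
by apply: (sub_measurable (sF k)); exact: stN.
Qed.

Let stopped_exp lam w n : (N w <= n)%N -> exp_martingale lam ak n w =
  expR (lam * stopped_sum (fun k w => a k w * e k w) w
        - (1 + gamma) / mu * lam ^+ 2 * stopped_sum a w).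
Proof.
move=> Nn; rewrite /exp_martingale; congr expR.
rewrite (big_cat_nat _ Nn)//= [X in _ + X]big_nat_cond [X in _ + X]big1 ?addr0.
  rewrite /stopped_sum !mulr_sumr -sumrB big_nat [RHS]big_nat.
  by apply: eq_bigr => k /= kN; rewrite /ak kN mulr1 mulrA.
move=> k /andP[/andP[Nk _] _].
by rewrite /ak ltnNge Nk/= !mulr0 mul0r subrr.
Qed.

Let Q lam w := expR (lam * stopped_sum (fun k w => a k w * e k w) w
        - (1 + gamma) / mu * lam ^+ 2 * stopped_sum a w).

Let mQ0 lam : measurable_fun [set: T] (fun w =>
  lam * stopped_sum (fun k w => a k w * e k w) w
        - (1 + gamma) / mu * lam ^+ 2 * stopped_sum a w).
Proof.
apply: measurable_funB; apply: measurable_funM => //;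
  apply: measurable_stopped_sum => k.
  by apply: measurable_funM; [exact: sub (ma k)|exact: sub (me k)].
exact: sub (ma k).
Qed.

(** [N] is finite but unbounded, so the bound at fixed times passes to [N] by Fatou's lemma. *)
Let EQ (lam : R) : 0 <= lam -> (\int[P]_w (Q lam w)%:E <= 1)%E.
Proof.
move=> lam0.
have Qlim w : (Q lam w)%:E = limn_einf (fun n => (exp_martingale lam ak n w)%:E).
  apply/esym; have : (exp_martingale lam ak n w)%:E @[n --> \oo] --> (Q lam w)%:E.
    by apply: cvg_near_cst; exists (N w) => // n /= Nn; rewrite stopped_exp.
  by case/cvg_limn_einf_sup.
under eq_integral do rewrite Qlim.
apply: (le_trans (fatou _ _ _ _)) => //.
- by move=> n; apply/measurable_EFinP/(@sub _ _ n)/measurable_exp_martingale.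
- by move=> n w _; rewrite lee_fin expR_ge0.
- rewrite limn_einf_lim; apply: lime_le; first exact: is_cvg_einfs.
  apply: nearW => n; apply: ge_ereal_inf.
  exists (\int[P]_w (exp_martingale lam ak n w)%:E)%E.
    by exists n => /=.
  apply: integral_exp_martingale_le1 => // k w.
    by rewrite mulr_ge0.
  rewrite /ak; case: (k < N w)%N; first by rewrite mulr1.
  by rewrite mulr0 mul0r.
Qed.

(** Markov's inequality for [Q lam], whose mean is at most 1. *)
Lemma stopped_tail (lam y : R) : 0 <= lam ->
  (P [set w | (y <= lam * stopped_sum (fun k w => a k w * e k w) w
        - (1 + gamma) / mu * lam ^+ 2 * stopped_sum a w)%R] <=
   (expR (- y))%:E)%E.
Proof.
move=> lam0; set A := [set w | _].
have mA : measurable A.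
  have := @mQ0 lam measurableT _ (measurable_itv `[y, +oo[).
  rewrite setTI (_ : _ @^-1` _ = A)//.
  by apply/seteqP; split=> w /=; rewrite /A /= in_itv/= andbT.
rewrite expRN -[leRHS]mule1 lee_pdivlMl ?expR_gt0//.
apply: (le_trans _ (EQ lam0)).
rewrite -integral_cst// integral_mkcond.
apply: ge0_le_integral => //.
- by move=> w _; rewrite /patch; case: ifP; rewrite lee_fin ?expR_ge0.
- apply/(measurable_restrictT _ mA); exact: measurable_cst.
- by apply/measurable_EFinP; apply: measurableT_comp => //; exact: mQ0.
- move=> w _; rewrite /patch; case: ifPn => [|_]; last by rewrite lee_fin expR_ge0.
  by rewrite inE => Aw; rewrite lee_fin ler_expR.
Qed.

End stopped_martingale.

(** * The assumptions on the errors in integrated form *)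

Section conditional_hypotheses.
Context d (T : measurableType d) (R : realType) (P : probability T R).
Variables (G : set (set T)).
Hypotheses (sG : sigma_algebra setT G) (GT : G `<=` measurable).

Let measurable_wrt_EFin (g : T -> R) :
  measurable_wrt G g -> measurable_wrt G (fun w => (g w)%:E).
Proof.
move=> /(measurable_wrtP sG) mg; apply/(measurable_wrtP sG).
exact/measurable_EFinP.
Qed.

(** [Zp] and [Zn] are almost surely finite with difference 0, hence almost surely equal. *)
Lemma cond_exp0_centered (e : T -> R) : measurable_fun [set: T] e ->
  cond_exp P G e (cst 0) -> centered_wrt P G e.
Proof.
move=> me [_ [Zp [Zn [cp cn fin eq0]]]] g mg g0.
have sub (Z : T -> \bar R) X : cond_exp_ge0 P G X Z -> measurable_fun [set: T] Z.
  by case=> /(measurable_wrtP sG) mZ _ _; exact: (measurable_fun_sub sG GT).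
have max0 (x : R) : 0 <= Num.max x 0 by rewrite le_max lexx orbT.
under eq_integral do rewrite EFinM.
under [RHS]eq_integral do rewrite EFinM.
rewrite (cond_exp_ge0_mul sG GT _ _ cp (measurable_wrt_EFin mg))//; last 2 first.
- by apply/measurable_EFinP; exact: measurable_maxr.
- by move=> w; rewrite lee_fin.
rewrite (cond_exp_ge0_mul sG GT _ _ cn (measurable_wrt_EFin mg))//; last 2 first.
- by apply/measurable_EFinP; apply: measurable_maxr => //; exact: measurable_funN.
- by move=> w; rewrite lee_fin.
have mg' : measurable_fun [set: T] (fun w => (g w)%:E).
  apply/measurable_EFinP/(measurable_fun_sub sG GT).
  exact/(measurable_wrtP sG).
apply: ae_eq_integral => //.
- by apply: emeasurable_funM => //; exact: sub cp.
- by apply: emeasurable_funM => //; exact: sub cn.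
- apply: filterS2 fin eq0 => w [fp fn] /= eq0 _; congr (_ * _)%E.
  have [_ p0 _] := cp; have [_ n0 _] := cn.
  move: (p0 w) (n0 w) fp fn eq0.
  case: (Zp w) => // p; case: (Zn w) => // n _ _ _ _ [/esym/eqP].
  by rewrite subr_eq0 => /eqP ->.
Qed.

Lemma centered_wrtN (e : T -> R) :
  centered_wrt P G e -> centered_wrt P G (fun w => - e w).
Proof.
move=> ce g mg g0; rewrite -(ce g mg g0).
by under [RHS]eq_integral do rewrite opprK.
Qed.

Lemma cond_exp_exp_sqr_le (mu gamma : R) (e s : T -> R) (Z : T -> \bar R) :
  0 <= gamma -> measurable_fun [set: T] e -> measurable_wrt G s ->
  cond_exp_ge0 P G
    (fun w => (expR (mu * (e w ^+ 2 / s w ^+ 2)))%:E) Z ->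
  {ae P, forall w, (Z w <= gamma%:E)%E} ->
  exp_sqr_le_wrt P G mu gamma e s.
Proof.
move=> gamma0 me ms cZ Zle g mg g0.
have mg' : measurable_fun [set: T] g.
  by apply/(measurable_fun_sub sG GT)/(measurable_wrtP sG).
have ms' : measurable_fun [set: T] s.
  by apply/(measurable_fun_sub sG GT)/(measurable_wrtP sG).
have mZ : measurable_fun [set: T] Z.
  by case: cZ => /(measurable_wrtP sG) mZ _ _; exact: (measurable_fun_sub sG GT).
under eq_integral do rewrite EFinM.
rewrite (cond_exp_ge0_mul sG GT _ _ cZ (measurable_wrt_EFin mg))//; last first.
  apply/measurable_EFinP; apply: measurableT_comp => //.
  apply: measurable_funM => //; apply: measurable_funM.
    exact: measurable_funX.
  by apply: measurable_funV; exact: measurable_funX.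
rewrite -ge0_integralZl//; [|exact/measurable_EFinP|by move=> w _; rewrite lee_fin].
case: cZ => _ Z0 _.
apply: ae_ge0_le_integral => //.
- by move=> w _; rewrite mule_ge0// lee_fin.
- by apply: emeasurable_funM => //; exact/measurable_EFinP.
- by move=> w _; rewrite mule_ge0// lee_fin.
- by apply: emeasurable_funM => //; exact/measurable_EFinP.
- by apply: filterS Zle => w h _; rewrite muleC lee_wpmul2r// lee_fin.
Qed.

Lemma exp_sqr_le_wrtN (mu gamma : R) (e s : T -> R) :
  exp_sqr_le_wrt P G mu gamma e s ->
  exp_sqr_le_wrt P G mu gamma (fun w => - e w) s.
Proof.
by move=> he g mg g0; under eq_integral do rewrite sqrrN; exact: he.
Qed.

End conditional_hypotheses.

(** * Lepski's rule at a fixed outcome *)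

Section lepski_pathwise.
Context (R : realType) (h0 q b : R) (L : R -> R).
Hypotheses (h00 : 0 < h0) (q01 : 0 < q < 1) (b0 : 0 < b).
Hypothesis L0 : forall h, 0 <= L h.
Hypothesis Lmon : forall h h', h <= h' -> L h <= L h'.
Local Notation bw j := (h0 * q ^+ j).
Local Notation HH := (bandwidths h0 q L).
Local Notation r := (rate h0 b L).

Let q0 : 0 < q. Proof. by case/andP: q01. Qed.
Let q1 : q < 1. Proof. by case/andP: q01. Qed.

Lemma bw_gt0 j : 0 < bw j.
Proof. by rewrite mulr_gt0// exprn_gt0. Qed.

Lemma bw_le i j : (bw i <= bw j) = (j <= i)%N.
Proof. by rewrite ler_pM2l// ler_iXn2l. Qed.

Lemma psi_bw j : psi h0 b (bw j) = 1 + b * (- ln q) * j%:R.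
Proof.
rewrite /psi; congr (1 + _); rewrite -mulrA; congr (b * _).
have h0n : h0 != 0 by rewrite gt_eqF.
rewrite invfM mulrA mulfV// mul1r.
by rewrite lnV ?posrE ?exprn_gt0// lnXn// mulNr mulr_natr.
Qed.

Lemma lnq_lt0 : 0 < - ln q.
Proof. by rewrite oppr_gt0 ln_lt0// q0. Qed.

Lemma psi_ge1 h : HH h -> 1 <= psi h0 b h.
Proof.
move=> [j -> _]; rewrite psi_bw lerDl.
by rewrite mulr_ge0// mulr_ge0 ?(ltW b0)// ltW// lnq_lt0.
Qed.

Lemma rate_le h h' : HH h -> HH h' -> h <= h' -> r h' <= r h.
Proof.
move=> [i -> Li] [j -> Lj]; rewrite bw_le => ij.
rewrite /rate ler_wsqrtr// ler_pM//.
- by rewrite (le_trans ler01)// psi_ge1//; exists j.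
- by rewrite invr_ge0.
- by rewrite !psi_bw lerD2l ler_pM2l ?mulr_gt0 ?lnq_lt0// ler_nat.
- by rewrite lef_pV2// Lmon// bw_le.
Qed.

Lemma rate_h0 : r h0 = (Num.sqrt (L h0))^-1.
Proof.
by rewrite /rate /psi divff ?gt_eqF// ln1 mulr0 addr0 div1r sqrtrV.
Qed.

Lemma rate_ge0 h : 0 <= r h. Proof. exact: sqrtr_ge0. Qed.

(** A rate at most [u] forces psi <= u^2 L(h0), and psi grows linearly in the index. This makes the
    minima defining [Hu] and [Hst] exist. *)
Lemma bw_rate_le_bounded u : exists n,
  forall j, HH (bw j) -> r (bw j) <= u -> (j <= n)%N.
Proof.
exists (Num.truncn (u ^+ 2 * L h0 / (b * (- ln q)))) => j Hj ru.
have [i _ Lj] := Hj.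
have psi0 : 0 <= psi h0 b (bw j) by rewrite (le_trans ler01)// psi_ge1.
have : r (bw j) ^+ 2 <= u ^+ 2.
  by rewrite lerXn2r// nnegrE ?rate_ge0// (le_trans (rate_ge0 _) ru).
rewrite /rate sqr_sqrtr; last by rewrite divr_ge0.
rewrite ler_pdivrMr// psi_bw => h.
have bq : 0 < b * - ln q by rewrite mulr_gt0// lnq_lt0.
rewrite truncn_ge_nat; last first.
  by rewrite divr_ge0 ?(ltW bq)// mulr_ge0// sqr_ge0.
rewrite ler_pdivlMr// mulrC.
have : L (bw j) <= L h0 by apply: Lmon; rewrite -[leRHS]mulr1 -(expr0 q) bw_le.
have := sqr_ge0 u; nra.
Qed.

(** Bandwidths decrease with the index, so the minimum is reached at the largest index, which exists
    thanks to the bound [n]. *)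
Lemma set_min_bw (A : set R) n : A !=set0 -> A `<=` HH ->
  (forall j, A (bw j) -> (j <= n)%N) ->
  A (set_min A) /\ lbound A (set_min A).
Proof.
move=> [h Ah] AH bdA.
suff [x Ax] : exists x, (A `&` lbound A) x by exact: (xgetPex 0 (ex_intro _ x Ax)).
have ex : exists j, `[< A (bw j) >].
  by have [j hE _] := AH _ Ah; exists j; apply/asboolP; rewrite -hE.
have ub j : `[< A (bw j) >] -> (j <= n)%N by move=> /asboolP; exact: bdA.
case: (ex_maxnP ex ub) => m /asboolP Am maxm.
exists (bw m); split=> // y Ay; have [i yE _] := AH _ Ay.
by rewrite yE bw_le; apply: maxm; apply/asboolP; rewrite -yE.
Qed.

Lemma set_max_bw (A : set R) : A !=set0 -> A `<=` HH ->
  A (set_max A) /\ ubound A (set_max A).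
Proof.
move=> [h Ah] AH.
suff [x Ax] : exists x, (A `&` ubound A) x by exact: (xgetPex 0 (ex_intro _ x Ax)).
have ex : exists j, `[< A (bw j) >].
  by have [j hE _] := AH _ Ah; exists j; apply/asboolP; rewrite -hE.
case: (ex_minnP ex) => m /asboolP Am minm.
exists (bw m); split=> // y Ay; have [i yE _] := AH _ Ay.
by rewrite yE bw_le; apply: minm; apply/asboolP; rewrite -yE.
Qed.

Variables (u0 delta0 alpha0 nu : R).
Hypotheses (u00 : 0 < u0) (d00 : 0 < delta0) (al0 : 0 < alpha0) (nu0 : 0 < nu).
Variables (W fhat : R -> R).
Local Notation Wb := (barW h0 u0 delta0 alpha0 W).
Local Notation Hu := (H_ h0 q b L u0).
Local Notation Hst := (Hstar h0 q b L Wb).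
Local Notation Hh := (hatH h0 q b u0 nu L fhat).

Lemma barW_le h : Wb h <= u0.
Proof. by rewrite /barW ge_min lexx orbT. Qed.

Definition oracle_set := [set h | HH h /\ r h <= Wb h].
Definition lepski_set := [set h | [/\ HH h, Hu <= h &
    forall h', HH h' -> Hu <= h' <= h ->
      `|fhat h - fhat h'| <= nu * r h']].

Hypothesis start : rsqrt_le (L h0) (Wb h0).

Lemma HH_h0 : HH h0.
Proof. by exists 0%N; [rewrite expr0 mulr1|case: start]. Qed.

Lemma Hu_spec : [/\ HH Hu, r Hu <= u0 & forall h, HH h -> r h <= u0 -> Hu <= h].
Proof.
have [n bd] := bw_rate_le_bounded u0.
have [] := @set_min_bw [set h | HH h /\ r h <= u0] n.
- exists h0; split; first exact: HH_h0.
  by rewrite rate_h0 (le_trans (proj2 start))// barW_le.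
- by move=> h [].
- by move=> j [Hj rj]; exact: bd.
by move=> [H1 H2] H3; split=> // h Hh rh; exact: H3.
Qed.

Lemma Hstar_spec : oracle_set Hst /\ lbound oracle_set Hst.
Proof.
have [n bd] := bw_rate_le_bounded u0.
apply: (@set_min_bw _ n).
- exists h0; split; first exact: HH_h0.
  by rewrite rate_h0; case: start.
- by move=> h [].
- by move=> j [Hj rj]; apply: bd => //; exact: le_trans rj (barW_le _).
Qed.

Lemma hatH_spec : lepski_set Hh /\ ubound lepski_set Hh.
Proof.
have [H1 H2 H3] := Hu_spec.
apply: set_max_bw; last by move=> h [].
(* [Hu] is admissible, being compared with itself only. *)
exists Hu; split=> // h' Hh' /le_anti <-.
by rewrite subrr normr0 mulr_ge0 ?rate_ge0// ltW.
Qed.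

Variables (ftil : R -> R) (fx t s : R).

(** [barW] with the random [W] left out: a deterministic lower bound for it. *)
Definition threshold h := Num.min (delta0 * (h / h0) `^ alpha0) u0.

(* L h has no upper bound; the truncation by [threshold] makes a finite grid of
   exponents suffice in [noise_union_bound]. *)
Definition large_noise c h := [/\ HH h, r h <= u0 &
  c * Num.max (r h) (threshold h) <= `|fhat h - ftil h|].

Hypothesis bias : forall h h', HH h -> HH h' -> Hu <= h' <= h ->
  `|ftil h' - fx| <= W h.
Hypothesis WHst : W Hst <= u0.
Hypothesis error : t * Wb Hst <= `|fhat Hh - fx|.
Hypotheses (s0 : 0 <= s) (sK : s * (1 + 8 / nu) <= t - 1)
  (snu : s <= t - 1 - nu) (st : s < t - 1).

Lemma scale_le h h' : HH h -> h <= h' ->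
  delta0 * (h / h0) `^ alpha0 <= delta0 * (h' / h0) `^ alpha0.
Proof.
move=> [j -> _] hh'.
rewrite ler_pM2l// ge0_ler_powR ?nnegrE ?(ltW al0)//.
- by rewrite divr_ge0// ltW// bw_gt0.
- by rewrite divr_ge0 ?(ltW h00)// (le_trans _ hh')// ltW// bw_gt0.
- by rewrite ler_pM2r ?invr_gt0.
Qed.

Lemma threshold_le h h' : HH h -> h <= h' -> threshold h <= threshold h'.
Proof.
by move=> Hh hh'; rewrite /threshold le_min !ge_min lexx orbT scale_le.
Qed.

Lemma threshold_barW h : threshold h <= Wb h.
Proof.
by rewrite /threshold /barW le_min !ge_min le_max !lexx !orbT.
Qed.

Lemma threshold_le_u0 h : threshold h <= u0.
Proof. by rewrite /threshold ge_min lexx orbT. Qed.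

Let dist2 (x y z : R) : (`|x - z| : R) <= (`|x - y| : R) + (`|y - z| : R).
Proof. exact: ler_distD. Qed.

(** Triangle inequalities only. Either [Hst] is one of the bandwidths that [Hh] was compared with,
    or [Hh] < [Hst] and the next bandwidth above [Hh] was rejected. *)
Lemma lepski_cases : (exists h, large_noise s h) \/
  (exists2 h, large_noise (3 / 8 * nu) h &
     delta0 * (h / h0) `^ alpha0 <= s * u0 / (t - 1)).
Proof.
have err := error.
have [HHu rHu minHu] := Hu_spec.
have [[HHst rHst] minHst] := Hstar_spec.
have [[HHh Hule adm] maxHh] := hatH_spec.
have Wst : W Hst <= Wb Hst by rewrite /barW le_min WHst le_max lexx.
have Hust : Hu <= Hst by apply: minHu => //; exact: le_trans rHst (barW_le _).
have t1 : 0 < t - 1 by exact: le_lt_trans st.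
have Wb0 : 0 <= Wb Hst by exact: le_trans (rate_ge0 _) rHst.
(* If [Hst] <= [Hh], the rule costs nu Wbar and the bias Wbar, which leaves (t - 1 - nu) Wbar for
   the noise at [Hst]. *)
have [stHh|Hhst] := leP Hst Hh.
  left; exists Hst; split=> //; first exact: le_trans rHst (barW_le _).
  have maxW : Num.max (r Hst) (threshold Hst) <= Wb Hst.
    by rewrite ge_max rHst threshold_barW.
  have d1 : (`|fhat Hh - fhat Hst| : R) <= nu * r Hst.
    by apply: adm => //; rewrite Hust.
  have d2 : (`|ftil Hst - fx| : R) <= W Hst by apply: bias => //; rewrite Hust lexx.
  have tri1 := dist2 (fhat Hh) (fhat Hst) fx.
  have tri2 := dist2 (fhat Hst) (ftil Hst) fx.
  have d3 : nu * r Hst <= nu * Wb Hst by rewrite ler_pM2l.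
  apply: (@le_trans _ _ (s * Wb Hst)); first by rewrite ler_wpM2l.
  have : s * Wb Hst <= (t - 1 - nu) * Wb Hst by rewrite ler_wpM2r.
  by move=> sW; lra.
have noise : (t - 1) * Wb Hst <= `|fhat Hh - ftil Hh|.
  have d2 : (`|ftil Hh - fx| : R) <= W Hst by apply: bias => //; rewrite Hule ltW.
  by have := dist2 (fhat Hh) (ftil Hh) fx => tri; lra.
have rHh : r Hh <= u0 by exact: le_trans (rate_le HHu HHh Hule) rHu.
have thr h : HH h -> h <= Hst -> threshold h <= Wb Hst.
  by move=> Hh' hst; exact: le_trans (threshold_le Hh' hst) (threshold_barW _).
have nuV : 0 < 8 / nu by rewrite divr_gt0.
have WK : Wb Hst <= (1 + 8 / nu) * Wb Hst by rewrite ler_peMl// lerDl ltW.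
(* If the rate at [Hh] is comparable to Wbar, the noise at [Hh] is already large; this is the use of
   [sK]. *)
have [rK|rK] := leP (r Hh) ((1 + 8 / nu) * Wb Hst).
  left; exists Hh; split=> //; apply: le_trans noise.
  apply: (@le_trans _ _ (s * ((1 + 8 / nu) * Wb Hst))).
    by rewrite ler_wpM2l// ge_max rK (le_trans (thr _ HHh (ltW Hhst))).
  by rewrite mulrA ler_wpM2r.
have [big|small] := leP (s * Num.max (r Hh) (threshold Hh)) `|fhat Hh - ftil Hh|.
  by left; exists Hh.
right; set tau := s * u0 / (t - 1).
(* The noise at [Hh] lies between (t - 1) Wbar and s u0. *)
have Wtau : Wb Hst <= tau.
  rewrite /tau ler_pdivlMr// mulrC (le_trans noise)// (le_trans (ltW small))//.
  by rewrite ler_wpM2l// ge_max rHh threshold_le_u0.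
have scale_tau h : HH h -> h <= Hst -> delta0 * (h / h0) `^ alpha0 <= tau.
  move=> Hh' /(scale_le Hh') /le_trans; apply.
  have : threshold Hst <= tau by exact: le_trans (threshold_barW _) Wtau.
  rewrite /threshold ge_min => /orP[//|].
  (* The minimum in [threshold] is not [u0]: u0 <= tau would contradict s < t - 1. *)
  rewrite /tau ler_pdivlMr// mulrC ler_pM2r// leNgt.
  by rewrite st.
have [j hE Lj] := HHh; have [i stE Li] := HHst.
rewrite hE in rK Hule Hhst rHh maxHh.
rewrite stE in Hhst; move: Hhst; rewrite ltNge bw_le -ltnNge => ij.
(* [Hh] < [Hst] makes the index of [Hh] positive, so [bw j] is the bandwidth just above it; it is
   still at most [Hst]. *)
case: j => [//|j] in hE Lj ij rK Hule rHh maxHh *.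
have HHj : HH (bw j.+1) by exists j.+1; rewrite // -hE.
have HHp : HH (bw j).
  by exists j => //; rewrite (lt_le_trans Lj)// hE Lmon// bw_le.
have pst : bw j <= Hst by rewrite stE bw_le -ltnS.
have Hup : Hu <= bw j by rewrite (le_trans Hule)// bw_le.
(* By maximality of [Hh], [bw j] fails the test against some [h']. *)
have [h' [HHh' /andP[Huh' h'p] viol]] : exists h', [/\ HH h', Hu <= h' <= bw j &
    nu * r h' < `|fhat (bw j) - fhat h'|].
  apply: contrapT => noex; have : lepski_set (bw j).
    split=> // h' HHh' h'b; rewrite leNgt; apply/negP => viol.
    by apply: noex; exists h'.
  by move=> /maxHh; rewrite bw_le ltnn.
(* [bw j] does not fail against itself, so [h'] is at most [Hh] and its rate at least that of
   [Hh]. *)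
have h'j : h' <= bw j.+1.
  have [k kE _] := HHh'; rewrite kE bw_le ltnNge; apply/negP => kj.
  have h'E : h' = bw j by apply/le_anti; rewrite h'p kE bw_le.
  move: viol; rewrite h'E subrr normr0 ltNge mulr_ge0 ?rate_ge0//.
  exact: ltW.
(* The two biases, at most 2 Wbar in total, take a quarter of nu * r h'. *)
have rh' : (1 + 8 / nu) * Wb Hst < r h' by rewrite (lt_le_trans rK)// rate_le.
have W8 : 8 * Wb Hst <= nu * r h'.
  have -> : 8 * Wb Hst = nu * (8 / nu * Wb Hst) by field; rewrite gt_eqF.
  by rewrite ler_pM2l//; rewrite mulrDl mul1r in rh'; lra.
have bp : (`|fx - ftil (bw j)| : R) <= Wb Hst.
  by rewrite distrC (le_trans _ Wst)// bias// Hup.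
have bh' : (`|ftil h' - fx| : R) <= Wb Hst.
  by rewrite (le_trans _ Wst)// bias// Huh' (le_trans h'p).
have h'st : h' <= Hst by exact: le_trans h'p pst.
have rp : r (bw j) <= r h' by exact: rate_le.
have rh'u : r h' <= u0 by rewrite (le_trans _ rHu)// rate_le.
have mp : Num.max (r (bw j)) (threshold (bw j)) <= r h'.
  by rewrite ge_max rp (le_trans (thr _ HHp pst))// (le_trans WK)// ltW.
have m' : Num.max (r h') (threshold h') <= r h'.
  by rewrite ge_max lexx (le_trans (thr _ HHh' h'st))// (le_trans WK)// ltW.
have c0 : 0 <= 3 / 8 * nu by rewrite mulr_ge0// ltW.
have tri1 := dist2 (fhat (bw j)) (ftil (bw j)) (fhat h').
have tri2 := dist2 (ftil (bw j)) fx (fhat h').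
have tri3 := dist2 fx (ftil h') (fhat h').
rewrite [`|ftil (bw j) - fx|]distrC in tri2.
rewrite [`|fx - ftil h'|]distrC [`|ftil h' - fhat h'|]distrC in tri3.
(* The remaining three quarters of nu * r h' are shared by the noises at [bw j] and [h']; one of
   them has at least half, hence 3 / 8. *)
have [n'|n'] := leP (3 / 8 * nu * r h') `|fhat h' - ftil h'|.
  exists h'; last exact: scale_tau.
  by split=> //; rewrite (le_trans _ n')// ler_wpM2l.
exists (bw j); last exact: scale_tau.
split=> //; first exact: le_trans rp rh'u.
apply: (@le_trans _ _ (3 / 8 * nu * r h')); first by rewrite ler_wpM2l.
lra.
Qed.

End lepski_pathwise.

(** * Uniform control of the noise over the bandwidths *)

(** The best exponent would be s m / (2 c), with m the truncated rate, but m is random. Replacing m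
    by a dyadic g with g <= m <= 2 g keeps at least 3 / 4 of the optimal value s^2 L m^2 / (4 c). *)
Lemma exp_tilt_at_scale (R : realType) (u0 s c psi L M th : R) (n : nat) :
  0 < c -> 0 < s -> 0 <= psi -> 0 < L -> Num.sqrt (psi / L) <= u0 ->
  th <= u0 -> u0 / 2 ^+ n <= th ->
  s * Num.max (Num.sqrt (psi / L)) th <= `|L^-1 * M| ->
  exists2 i, (i <= n)%N &
    let lam := s * (u0 / 2 ^+ i) / (2 * c) in
    3 / 16 * s ^+ 2 / c * psi <= lam * `|M| - c * lam ^+ 2 * L.
Proof.
move=> c0 s0 psi0 L0 ru0 thu0 nth.
set m := Num.max _ _ => sm.
have thm : th <= m by rewrite le_max lexx orbT.
have rm : Num.sqrt (psi / L) <= m by rewrite le_max lexx.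
have mu0 : m <= u0 by rewrite ge_max ru0 thu0.
have psim : psi <= L * m ^+ 2.
  rewrite mulrC -ler_pdivrMr// -[leLHS]sqr_sqrtr ?divr_ge0// ?(ltW L0)//.
  by rewrite lerXn2r// nnegrE ?sqrtr_ge0// (le_trans (sqrtr_ge0 _) rm).
have sM : s * m * L <= (`|M| : R).
  by move: sm; rewrite normrM ger0_norm ?invr_ge0 ?(ltW L0)// [leRHS]mulrC ler_pdivlMr.
have ex : exists i, u0 / 2 ^+ i <= m by exists n; exact: le_trans nth thm.
have := ex_minnP ex; case=> i gm mini.
exists i; first by apply: mini; exact: le_trans nth thm.
set g := u0 / 2 ^+ i in gm *.
(* By minimality of [i] the previous grid point exceeds [m]; at index 0, g is [u0] itself. *)
have m2g : m <= 2 * g.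
  case: i @g gm mini => [|i] g gm mini.
    rewrite /g expr0 divr1; have : 0 <= m by exact: le_trans (sqrtr_ge0 _) rm.
    by move=> m0; lra.
  have /ltW : m < u0 / 2 ^+ i.
    by rewrite ltNge; apply/negP => /mini; rewrite ltnn.
  have -> // : 2 * g = u0 / 2 ^+ i.
  by rewrite /g exprS; field; rewrite expf_neq0.
move=> /=; set lam := s * g / (2 * c).
have m0 : 0 <= m by exact: le_trans (sqrtr_ge0 _) rm.
have g0 : 0 <= g by lra.
have lam0 : 0 <= lam by apply: divr_ge0; apply: mulr_ge0 => //; exact: ltW.
apply: (@le_trans _ _ (lam * (s * m * L) - c * lam ^+ 2 * L)); last first.
  by rewrite lerD2r ler_wpM2l.
have -> : lam * (s * m * L) - c * lam ^+ 2 * L =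
    s ^+ 2 / (4 * c) * (L * (2 * g * m - g ^+ 2)).
  by rewrite /lam; field; rewrite gt_eqF.
have -> : 3 / 16 * s ^+ 2 / c * psi = s ^+ 2 / (4 * c) * (3 / 4 * psi).
  by field; rewrite gt_eqF.
rewrite ler_wpM2l ?divr_ge0 ?sqr_ge0 ?mulr_ge0 ?(ltW c0)//.
apply: (@le_trans _ _ (3 / 4 * (L * m ^+ 2))); first by rewrite ler_wpM2l.
rewrite mulrCA ler_pM2l//.
(* This product is 2 g m - g^2 - (3 / 4) m^2. *)
have : 0 <= (g - m / 2) * (3 / 2 * m - g) by rewrite mulr_ge0//; lra.
by move=> h; lra.
Qed.

(** Split x^j = z^j z^j with z = sqrt x: Bernoulli's inequality for 1 / z bounds j z^j, and the
    other factor is summed as a geometric series. *)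
Lemma affine_geometric_sum_bounded (R : realType) (A B x : R) :
  0 <= A -> 0 <= B -> 0 < x < 1 ->
  exists2 S, 0 < S & forall n, \sum_(0 <= j < n) (A + B * j%:R) * x ^+ j <= S.
Proof.
move=> A0 B0 /andP[x0 x1].
pose z := Num.sqrt x.
have z0 : 0 < z by rewrite sqrtr_gt0.
have z1 : z < 1 by rewrite -sqrtr1 ltr_sqrt.
have zx : z ^+ 2 = x by rewrite sqr_sqrtr// ltW.
pose y := z^-1 - 1.
have y0 : 0 < y by rewrite subr_gt0 invf_gt1.
have jz j : j%:R * z ^+ j <= y^-1.
  have : 1 + y * j%:R <= (1 + y) ^+ j.
    elim: j => [|j IH]; first by rewrite mulr0 addr0 expr0.
    have j0 : 0 <= (j%:R : R) by [].
    rewrite exprS -[j.+1%:R]natr1.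
    apply: (@le_trans _ _ ((1 + y) * (1 + y * j%:R))); first by nra.
    by rewrite ler_wpM2l//; lra.
  rewrite /y addrCA subrr addr0 -/y => h.
  have zj : 0 < z ^+ j by rewrite exprn_gt0.
  rewrite -ler_pdivlMr// -[y^-1]mul1r -mulrA -invfM.
  move: h; rewrite exprVn => h.
  rewrite mul1r invfM ler_pdivlMl//; lra.
have z1' : 0 < 1 - z by rewrite subr_gt0.
have AB : 0 <= A + B / y by rewrite addr_ge0// divr_ge0// ltW.
have S0 : 0 <= (A + B / y) / (1 - z) by rewrite divr_ge0// ltW.
exists ((A + B / y) / (1 - z) + 1); first by lra.
move=> n; apply: (@le_trans _ _ (\sum_(0 <= j < n) (A + B / y) * z ^+ j)).
  apply: ler_sum_nat => j _; rewrite -zx -exprM mul2n -addnn exprD mulrA.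
  rewrite ler_wpM2r ?exprn_ge0 ?(ltW z0)// mulrDl lerD//.
    by rewrite ler_piMr// exprn_ile1 ?ltW.
  by rewrite -mulrA ler_wpM2l.
rewrite -mulr_sumr big_mkord.
have geo : \sum_(j < n) z ^+ j <= (1 - z)^-1.
  rewrite -[leRHS]mul1r ler_pdivlMr// mulrC.
  have := subrX1 z n; have : 0 <= z ^+ n by rewrite exprn_ge0 ?ltW.
  by move=> h1 h2; lra.
apply: (@le_trans _ _ ((A + B / y) / (1 - z))); first by rewrite ler_wpM2l.
by rewrite lerDl.
Qed.

Lemma exists_expn2_ge (R : realType) (x : R) : exists n, x <= 2 ^+ n.
Proof.
exists (Num.truncn x).+1; apply: (le_trans (ltW (truncnS_gt x))).
by rewrite -natrX ler_nat ltnW// ltn_expl.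
Qed.

(** [L] and [M] are both random, so the bound is on their joint exponent rather than on [M]
    alone. *)
Definition tail_bound d (T : measurableType d) (R : realType)
    (P : probability T R) (c : R) (L M : T -> R) := forall lam y, 0 <= lam ->
  let A := [set w | y <= lam * M w - c * lam ^+ 2 * L w] in
  measurable A /\ (P A <= (expR (- y))%:E)%E.

(** Union over bandwidths, grid exponents and the two signs. [S] is fixed before the probability
    space, [s] and [tau]. The two intended uses are all bandwidths at a high level, and small
    bandwidths at the fixed level [s1]. *)
Lemma noise_union_bound (R : realType) (c u0 delta0 p bq s1 rho : R) :
  0 < c -> 0 < u0 -> 0 < delta0 -> 0 < p < 1 -> 0 < bq -> 0 < s1 -> 0 < rho ->
  expR (- (3 / 16 * s1 ^+ 2 / c * bq)) * (p `^ rho)^-1 < 1 ->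
  exists2 S, 0 < S & forall d (T : measurableType d) (P : probability T R)
    (L M : nat -> T -> R),
  (forall j, tail_bound P c (L j) (M j)) ->
  (forall j, tail_bound P c (L j) (fun w => - M j w)) ->
  forall s tau, s1 <= s -> 0 < tau ->
  exists2 U : set T, measurable U /\
    (P U <= (S * expR (- (3 / 16 * s ^+ 2 / c)) * (tau / delta0) `^ rho)%:E)%E &
    forall w j, 0 < L j w -> Num.sqrt ((1 + bq * j%:R) / L j w) <= u0 ->
      s * Num.max (Num.sqrt ((1 + bq * j%:R) / L j w))
        (Num.min (delta0 * p ^+ j) u0) <= `|(L j w)^-1 * M j w| ->
      delta0 * p ^+ j <= tau -> U w.
Proof.
move=> c0 u00 d00 /andP[p0 p1] bq0 s10 rho0.
set z := expR (- (3 / 16 * s1 ^+ 2 / c * bq)) => x1.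
set x := z * _ in x1.
have prho : 0 < p `^ rho by rewrite powR_gt0.
have x0 : 0 < x by rewrite mulr_gt0 ?expR_gt0// invr_gt0.
have [n0 hn0] := exists_expn2_ge (u0 / delta0).
have [m hm] := exists_expn2_ge p^-1.
(* Number of halvings that bring [u0] below the truncation level at index j; it is affine in j
   because that level decays at most like p^j. *)
pose n j := (n0 + m * j)%N.
have hn j : u0 / 2 ^+ n j <= Num.min (delta0 * p ^+ j) u0.
  rewrite le_min; apply/andP; split; last first.
    rewrite ler_pdivrMr ?exprn_gt0// ler_peMr ?(ltW u00)//.
    by rewrite exprn_ege1// ler1n.
  rewrite ler_pdivrMr ?exprn_gt0// /n exprD exprM.
  have : (p^-1) ^+ j <= (2 ^+ m) ^+ j.
    by rewrite lerXn2r// nnegrE ?invr_ge0 ?exprn_ge0 ?(ltW p0).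
  rewrite exprVn -[leLHS]div1r ler_pdivrMr ?exprn_gt0// => h.
  rewrite ler_pdivrMr// in hn0.
  apply: (le_trans hn0).
  rewrite [leRHS](_ : _ = 2 ^+ n0 * delta0 * ((2 ^+ m) ^+ j * p ^+ j)); last by ring.
  by rewrite ler_peMr// mulr_ge0 ?exprn_ge0// ltW.
have [S S0 HS] : exists2 S, 0 < S & forall k, \sum_(0 <= j < k)
    (2 * n0.+1%:R + 2 * m%:R * j%:R) * x ^+ j <= S.
  by apply: affine_geometric_sum_bounded; rewrite ?mulr_ge0// x0.
exists S => // d T P L M tp tm s tau s1s tau0.
have s0 : 0 < s by exact: lt_le_trans s1s.
set K := expR (- (3 / 16 * s ^+ 2 / c)) * (tau / delta0) `^ rho.
have K0 : 0 <= K by rewrite mulr_ge0 ?expR_ge0 ?powR_ge0.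
pose y j := 3 / 16 * s ^+ 2 / c * (1 + bq * j%:R).
pose lam i := s * (u0 / 2 ^+ i) / (2 * c).
have lam0 i : 0 <= lam i.
  by rewrite /lam divr_ge0 ?mulr_ge0 ?divr_ge0 ?(ltW s0) ?(ltW u00) ?(ltW c0)// exprn_ge0.
pose A (j i : nat) := [set w | y j <= lam i * M j w - c * lam i ^+ 2 * L j w] `|`
  [set w | y j <= lam i * (- M j w) - c * lam i ^+ 2 * L j w].
have mA j i : measurable (A j i).
  by apply: measurableU; [exact: (tp j _ _ (lam0 i)).1|exact: (tm j _ _ (lam0 i)).1].
have PA j i : (P (A j i) <= (2 * expR (- y j))%:E)%E.
  apply: (le_trans (measureU2 _ _ _)).
  - exact: (tp j _ _ (lam0 i)).1.
  - exact: (tm j _ _ (lam0 i)).1.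
  - rewrite mulr_natl mulr2n EFinD leeD//.
      exact: (tp j _ _ (lam0 i)).2.
    exact: (tm j _ _ (lam0 i)).2.
pose B j := if delta0 * p ^+ j <= tau then \big[setU/set0]_(i < (n j).+1) A j i
            else set0.
have mB j : measurable (B j).
  by rewrite /B; case: ifP => // _; apply: bigsetU_measurable.
have PB j : (P (B j) <= (K * ((2 * n0.+1%:R + 2 * m%:R * j%:R) * x ^+ j))%:E)%E.
  have xj : 0 <= x ^+ j by rewrite exprn_ge0// ltW.
  rewrite /B; case: ifPn => [dp|_]; last first.
    by rewrite measure0 lee_fin !mulr_ge0 ?powR_ge0.
  apply: (le_trans (Boole_inequality _ _)) => //.
  apply: (@le_trans _ _ (\sum_(i < (n j).+1) (2 * expR (- y j))%:E)%E).
    by apply: lee_sum => i _; exact: PA.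
  rewrite sumEFin lee_fin sumr_const card_ord -[leLHS]mulr_natl.
  have -> : (n j).+1%:R = n0.+1%:R + m%:R * j%:R :> R.
    by rewrite /n -addSn natrD natrM.
  rewrite [leRHS](_ : _ = (n0.+1%:R + m%:R * j%:R) * (2 * (K * x ^+ j)));
    last by ring.
  rewrite ler_wpM2l ?addr_ge0 ?mulr_ge0// ler_pM2l//.
  (* Since s >= s1, the part of the exponent linear in j is bounded with [s1]; this keeps [S]
     independent of [s]. *)
  have yj : expR (- y j) <= expR (- (3 / 16 * s ^+ 2 / c)) * z ^+ j.
    rewrite /z -expRM_natl -expRD ler_expR /y.
    have : 3 / 16 * s1 ^+ 2 / c <= 3 / 16 * s ^+ 2 / c.
      rewrite ler_pM2r ?invr_gt0// ler_pM2l//.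
      by rewrite lerXn2r// nnegrE ltW.
    move=> h; have : 0 <= bq * j%:R by rewrite mulr_ge0// ltW.
    by nra.
  apply: (le_trans yj); rewrite /K -[leRHS]mulrA ler_wpM2l ?expR_ge0//.
  (* The constraint delta0 p^j <= tau gives 1 <= (tau / delta0)^rho p^(- rho j): the factor in [tau]
     is gained at the price of the ratio p^(- rho), which [x] contains. *)
  rewrite /x exprMn mulrCA ler_peMr ?exprn_ge0 ?expR_ge0//.
  rewrite exprVn ler_pdivlMr ?exprn_gt0// mul1r.
  have -> : (p `^ rho) ^+ j = (p ^+ j) `^ rho.
    by rewrite -powR_mulrn ?powR_ge0// -powRrM mulrC powRrM powR_mulrn// ltW.
  rewrite ge0_ler_powR ?nnegrE ?(ltW rho0) ?exprn_ge0 ?(ltW p0)//.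
    by rewrite divr_ge0// ltW.
  by rewrite ler_pdivlMr// mulrC.
exists (\bigcup_j B j); first split.
- exact: bigcupT_measurable.
- have mU : measurable (\bigcup_j B j) by exact: bigcupT_measurable.
  apply: (le_trans (generalized_Boole_inequality _ mB mU)).
  apply: lime_le; first by apply: is_cvg_nneseries => *.
  apply: nearW => k.
  apply: (@le_trans _ _ (\sum_(0 <= j < k)
    (K * ((2 * n0.+1%:R + 2 * m%:R * j%:R) * x ^+ j))%:E)%E).
    by apply: lee_sum => j _; exact: PB.
  rewrite sumEFin lee_fin -mulr_sumr -mulrA mulrC ler_wpM2r//.
- move=> w j Lj ru sM dp; exists j => //; rewrite /B dp.
  have psi0 : 0 <= 1 + bq * j%:R by rewrite addr_ge0// mulr_ge0// ltW.
  have thu : Num.min (delta0 * p ^+ j) u0 <= u0 by rewrite ge_min lexx orbT.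
  have [i iln] := exp_tilt_at_scale c0 s0 psi0 Lj ru thu (hn j) sM.
  rewrite -/(y j) -/(lam i) => yM.
  rewrite -bigcup_mkord; exists i => //=.
  have [M0|M0] := leP 0 (M j w).
    by left => /=; rewrite ger0_norm in yM.
  by right => /=; rewrite ltr0_norm in yM.
Qed.

(** * Measurability of the deviation event *)

Section measurable_predicates.
Context d (T : measurableType d) (R : realType).
Implicit Types (A B : T -> Prop) (f g : T -> R).

Lemma measurable_ler f g : measurable_fun [set: T] f ->
  measurable_fun [set: T] g -> measurable [set w | f w <= g w].
Proof.
move=> mf mg; have := measurable_fun_ler mf mg.
move=> /(_ measurableT [set true] I); rewrite setTI.
by rewrite (_ : _ @^-1` _ = [set w | f w <= g w]).
Qed.

Lemma measurable_ltr f g : measurable_fun [set: T] f ->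
  measurable_fun [set: T] g -> measurable [set w | f w < g w].
Proof.
move=> mf mg; rewrite (_ : [set _ | _] = ~` [set w | g w <= f w]).
  by apply: measurableC; exact: measurable_ler.
by apply/seteqP; split=> w /=; rewrite ltNge => /negP.
Qed.

Lemma measurable_imply A B : measurable [set w | A w] ->
  measurable [set w | B w] -> measurable [set w | A w -> B w].
Proof.
move=> mA mB; rewrite (_ : [set w | A w -> B w] = ~` [set w | A w] `|` [set w | B w]).
  by apply: measurableU => //; exact: measurableC.
apply/seteqP; split=> w /=; last by case.
by move=> AB; have [/AB|] := pselect (A w); [right|left].
Qed.

Lemma measurable_forall (A : nat -> T -> Prop) :
  (forall l, measurable [set w | A l w]) ->
  measurable [set w | forall l, A l w].
Proof.
move=> mA; rewrite (_ : [set _ | _] = \bigcap_l [set w | A l w]).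
  exact: bigcapT_measurable.
by apply/seteqP; split=> w /= h l; [move=> _; exact: h|exact: h].
Qed.

Lemma measurable_exists (A : nat -> T -> Prop) :
  (forall l, measurable [set w | A l w]) ->
  measurable [set w | exists l, A l w].
Proof.
move=> mA; rewrite (_ : [set _ | _] = \bigcup_l [set w | A l w]).
  exact: bigcupT_measurable.
by apply/seteqP; split=> w /= -[l]; [exists l|move=> _; exists l].
Qed.

Lemma measurable_prop (Q : Prop) : measurable [set w : T | Q].
Proof.
have [q|q] := pselect Q.
  by rewrite (_ : [set _ | _] = setT)//; apply/seteqP; split.
by rewrite (_ : [set _ | _] = set0)//; apply/seteqP; split.
Qed.

End measurable_predicates.

Lemma measurable_sqrtr (R : realType) : measurable_fun [set: R] (@Num.sqrt R).
Proof. by apply: continuous_measurable_fun; exact: sqrt_continuous. Qed.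

Section measurable_event.
Context d (T : measurableType d) (R : realType).
Variables (h0 q b u0 delta0 alpha0 nu : R).
Hypotheses (h00 : 0 < h0) (q01 : 0 < q < 1) (b0 : 0 < b).
Hypothesis nu0 : 0 < nu.
Variables (L fhat W : R -> T -> R).
Hypothesis L0 : forall w h, 0 <= L h w.
Hypothesis Lmon : forall w h h', h <= h' -> L h w <= L h' w.
Local Notation bw j := (h0 * q ^+ j).
Hypothesis mL : forall j, measurable_fun [set: T] (L (bw j)).
Hypothesis mf : forall j, measurable_fun [set: T] (fhat (bw j)).
Hypothesis mW : forall j, measurable_fun [set w | 0 < L (bw j) w] (W (bw j)).

Let r j w := rate h0 b (L ^~ w) (bw j).
(** [W] is assumed measurable only where the bandwidth is in use, so it is extended by 0. *)
Let W' j w := if 0 < L (bw j) w then W (bw j) w else 0.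
Let Wb' j w := Num.min (Num.max (W' j w) (delta0 * (bw j / h0) `^ alpha0)) u0.
Let HH' j w := 0 < L (bw j) w.
(** As bandwidths decrease with the index, a minimal bandwidth corresponds to a last index and a
    maximal one to a first index. *)
Let last (A : nat -> T -> Prop) i w := A i w /\ forall l, A l w -> (l <= i)%N.
Let oracle' i w := HH' i w /\ r i w <= Wb' i w.
Let coarse' k w := HH' k w /\ r k w <= u0.
Let lepski' k j w := HH' j w /\ ((j <= k)%N /\ forall l, HH' l w -> (j <= l <= k)%N ->
  `|fhat (bw j) w - fhat (bw l) w| <= nu * r l w).
Let start' w := 0 < L (bw 0) w /\ (Num.sqrt (L (bw 0) w))^-1 <= Wb' 0 w.

(** [i], [k] and [j] stand for the indices of the oracle, of the coarsest-rate bandwidth [H_] at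
    level [u0], and of the selected bandwidth. *)
Let event' t fx w := exists i k j, start' w /\ (last oracle' i w /\ (last coarse' k w /\
  ((lepski' k j w /\ forall l, lepski' k l w -> (j <= l)%N) /\
  (W' i w <= u0 /\ t * Wb' i w <= `|fhat (bw j) w - fx|)))).

Let mr j : measurable_fun [set: T] (r j).
Proof.
apply: (measurableT_comp (@measurable_sqrtr R)).
by apply: measurable_funM => //; exact: measurable_funV.
Qed.

Let mHH j : measurable [set w | HH' j w].
Proof. by apply: measurable_ltr. Qed.

Let mW' j : measurable_fun [set: T] (W' j).
Proof.
apply: measurable_fun_if => //.
- exact: measurable_fun_ltr.
- rewrite setTI; have := @mW j.
  by rewrite (_ : (fun w => _) @^-1` _ = [set w | 0 < L (bw j) w]).
Qed.

Let mWb' j : measurable_fun [set: T] (Wb' j).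
Proof. by apply: measurable_minr => //; exact: measurable_maxr. Qed.

Let mlast (A : nat -> T -> Prop) i : (forall l, measurable [set w | A l w]) ->
  measurable [set w | last A i w].
Proof.
move=> mA; apply: measurableI; first exact: mA.
apply: measurable_forall => l; apply: measurable_imply; first exact: mA.
exact: measurable_prop.
Qed.

Let mlepski k j : measurable [set w | lepski' k j w].
Proof.
apply: (measurableI _ _ (mHH j)); apply: measurableI; first exact: measurable_prop.
apply: measurable_forall => l; apply: measurable_imply; first exact: mHH.
apply: measurable_imply; first exact: measurable_prop.
apply: measurable_ler; last exact: measurable_funM.
by apply: measurableT_comp => //; exact: measurable_funB.
Qed.

Let mevent t fx : measurable [set w | event' t fx w].
Proof.
apply: measurable_exists => i; apply: measurable_exists => k.
apply: measurable_exists => j.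
apply: measurableI.
  apply: measurableI; first exact: mHH.
  apply: measurable_ler => //; apply: measurable_funV.
  exact: (measurableT_comp (@measurable_sqrtr R)).
apply: measurableI.
  apply: (@mlast oracle') => l.
  by apply: (measurableI _ _ (mHH l)); exact: measurable_ler.
apply: measurableI.
  apply: (@mlast coarse') => l.
  by apply: (measurableI _ _ (mHH l)); exact: measurable_ler.
apply: measurableI.
  apply: measurableI; first exact: mlepski.
  apply: measurable_forall => l; apply: measurable_imply; first exact: mlepski.
  exact: measurable_prop.
apply: measurableI; first exact: measurable_ler.
apply: measurable_ler; first exact: measurable_funM.
by apply: measurableT_comp => //; exact: measurable_funB.
Qed.

(** The selected bandwidths lie on a countable grid, so quantifying over their indices turns the
    event into countably many comparisons of measurable functions. *)
Lemma measurable_lepski_event (t fx : R) :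
  let Wbar h w := barW h0 u0 delta0 alpha0 (W ^~ w) h in
  let Hst w := Hstar h0 q b (L ^~ w) (Wbar ^~ w) in
  let Hhat w := hatH h0 q b u0 nu (L ^~ w) (fhat ^~ w) in
  measurable ([set w | t * Wbar (Hst w) w <= `|fhat (Hhat w) w - fx|] `&`
    [set w | rsqrt_le (L h0 w) (Wbar h0 w) /\ W (Hst w) w <= u0]).
Proof.
move=> Wbar Hst Hhat.
rewrite (_ : _ `&` _ = [set w | event' t fx w])//.
have W'E j w : HH' j w -> W' j w = W (bw j) w by rewrite /W' /HH' => ->.
have Wb'E j w : HH' j w -> Wb' j w = Wbar (bw j) w.
  by move=> Hj; rewrite /Wb' W'E.
have h0E : bw 0 = h0 by rewrite expr0 mulr1.
have HHE j w : HH' j w -> bandwidths h0 q (L ^~ w) (bw j) by exists j.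
have startE w : start' w <-> rsqrt_le (L h0 w) (Wbar h0 w).
  rewrite /start' /rsqrt_le h0E; split=> -[s1 s2]; split=> //.
    by rewrite -{2}h0E -Wb'E// /HH' h0E.
  by rewrite Wb'E ?h0E// /HH' h0E.
have ex w : rsqrt_le (L h0 w) (Wbar h0 w) -> exists i k j,
  [/\ last oracle' i w, last coarse' k w,
    lepski' k j w /\ (forall l, lepski' k l w -> (j <= l)%N) &
    Hst w = bw i /\ Hhat w = bw j].
  move=> st.
  have [HHu rHu minHu] := Hu_spec h00 q01 b0 (L0 w) (@Lmon w) st.
  have [[HHs rHs] minHs] := Hstar_spec h00 q01 b0 (L0 w) (@Lmon w) st.
  have [lepH maxH] := hatH_spec h00 q01 b0 (L0 w) (@Lmon w) nu0 (fhat ^~ w) st.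
  have [i Ei Li] := HHs; have [k Ek Lk] := HHu; have [HHh _ _] := lepH.
  have [j Ej Lj] := HHh.
  have lepE l : lepski' k l w <-> lepski_set h0 q b (L ^~ w) u0 nu (fhat ^~ w) (bw l).
    split=> [[Hl [lk H]]|[Hl kl H]].
      split; [exact: HHE|by rewrite Ek bw_le|].
      move=> h' [m -> Lm]; rewrite Ek !bw_le// andbC => ml; exact: H.
    have {}Hl : HH' l w by case: Hl => m El Ll.
    split=> //; split; first by rewrite Ek bw_le in kl.
    move=> m Hm lm; apply: H; first exact: HHE.
    by rewrite Ek !bw_le// andbC.
  exists i, k, j; split=> //.
  - split.
      have Hi : HH' i w by rewrite /HH' -Ei.
      by split=> //; rewrite Wb'E// /r -Ei.
    move=> l [Hl rl]; rewrite -(bw_le h00 q01) -Ei; apply: minHs.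
    by rewrite Wb'E// in rl; split; first exact: HHE.
  - split; first by split; rewrite /HH' /r -Ek.
    move=> l [Hl rl]; rewrite -(bw_le h00 q01) -Ek; apply: minHu => //.
    exact: HHE.
  - split; first by apply/lepE; rewrite -Ej.
    by move=> l /lepE /maxH; rewrite Ej bw_le.
(* Uniqueness of the indices identifies those supplied by [event'] with those of the actual minima
   and maximum. *)
have uniq A i i' w : last A i w -> last A i' w -> i = i'.
  by move=> [A1 m1] [A2 m2]; apply/eqP; rewrite eqn_leq m1 ?m2.
apply/seteqP; split=> w /=.
  move=> [err [st WH]]; have [i [k [j [Hi Hk Hj [Ei Ej]]]]] := ex w st.
  have HHi : HH' i w by case: Hi => -[].
  exists i, k, j; split; first exact/startE.
  do 3 split=> //; rewrite W'E// -Ei; split=> //.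
  by rewrite Wb'E// -Ei -Ej.
move=> [i [k [j [/startE st [Hi [Hk [Hj [WH err]]]]]]]].
have [i' [k' [j' [Hi' Hk' Hj' [Ei Ej]]]]] := ex w st.
have kk : k' = k by exact: uniq Hk' Hk.
rewrite kk in Hj'.
have jj : j' = j.
  apply/eqP; rewrite eqn_leq Hj'.2 ?Hj.2//; [exact: Hj'.1|exact: Hj.1].
rewrite (uniq _ _ _ _ Hi' Hi) in Ei; rewrite jj in Ej.
have HHi : HH' i w by case: Hi => -[].
rewrite Ei Ej; split; first by rewrite -Wb'E.
by split=> //; rewrite -W'E.
Qed.

End measurable_event.

(** * Measurability and tails of the kernel sums *)

Lemma continuous_sum (R : realType) (Z : topologicalType) (I : Type) (r : seq I)
    (g : I -> Z -> R) :
  (forall i, continuous (g i)) -> continuous (fun z => \sum_(i <- r) g i z).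
Proof.
move=> cg; elim: r => [|i r IH].
  rewrite (_ : (fun _ => _) = cst 0); first exact: cst_continuous.
  by apply/funext => z; rewrite big_nil.
rewrite (_ : (fun _ => _) = fun z => g i z + \sum_(j <- r) g j z).
  by move=> z; apply: continuousD; [exact: cg|exact: IH].
by apply/funext => z; rewrite big_cons.
Qed.

Lemma measurable_wrt_ball (T : Type) (G : set (set T)) (R : realType) n
    (X : T -> 'rV[R]_n) (x : 'rV[R]_n) (h : R) :
  vmeasurable_wrt G X -> G [set w | enorm (X w - x) <= h].
Proof.
move=> mX; apply: (mX [set z | enorm (z - x) <= h]).
rewrite (_ : [set z | _] = ~` [set z | h < enorm (z - x)]); last first.
  by apply/seteqP; split=> z /=; rewrite leNgt => /negP.
rewrite -setTD; apply: sigma_algebraCD; apply: sub_sigma_algebra => /=.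
have ccoord i : continuous (fun z : 'rV[R]_n => (z - x) ord0 i ^+ 2).
  move=> z; apply: (@continuous_comp _ _ _ (fun z : 'rV[R]_n => (z - x) ord0 i)
    (fun y : R => y ^+ 2)); last exact: exprn_continuous.
  rewrite (_ : (fun z : 'rV[R]_n => _) = fun z => z ord0 i - x ord0 i); last first.
    by apply/funext => u; rewrite !mxE.
  by apply: continuousB; [exact: coord_continuous|exact: cst_continuous].
have cont : continuous (fun z : 'rV[R]_n => enorm (z - x)).
  move=> z; apply: (@continuous_comp _ _ _ _ (@Num.sqrt R)).
    exact: (continuous_sum ccoord).
  exact: sqrt_continuous.
by move/continuousP : cont => /(_ _ (@open_gt R h)).
Qed.

Section kernel_noise.
Context d (T : measurableType d) (R : realType) (P : probability T R) (n : nat).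
Variables (x : 'rV[R]_n) (f : 'rV[R]_n -> R) (F : nat -> set (set T)).
Variables (X : nat -> T -> 'rV[R]_n) (Y eps sigma : nat -> T -> R) (N : T -> nat).
Variables (mu gamma : R).
Hypotheses (mu0 : 0 < mu) (gamma0 : 0 < gamma).
Hypothesis fF : filtration F.
Hypothesis mX : forall k, vmeasurable_wrt (F k) (X k).
Hypothesis mY : forall k, (1 <= k)%N -> measurable_wrt (F k) (Y k).
Hypothesis YE : forall k w, (1 <= k)%N -> Y k w = f (X k.-1 w) + eps k w.
Hypothesis meps : martingale_increment P F eps.
Hypothesis stN : stopping_time F N.
Hypothesis msig : forall k, measurable_wrt (F k) (sigma k).
Hypothesis sig0 : forall k w, 0 < sigma k w.
Hypothesis sg : sub_gaussian P F eps sigma mu gamma.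

Let sF k : sigma_algebra setT (F k). Proof. by case: fF. Qed.
Let FT k : F k `<=` measurable. Proof. by case: fF. Qed.
Let sub d' (U : measurableType d') k (g : T -> U) :
  measurable_wrt (F k) g -> measurable_fun [set: T] g.
Proof.
by move/(measurable_wrtP (sF k)); exact: (measurable_fun_sub (sF k) (@FT k)).
Qed.

Let a h k w := (sigma k w ^+ 2)^-1 * \1_[set z | enorm (z - x) <= h] (X k w).

Let s20 k w : 0 < sigma k w ^+ 2.
Proof. by rewrite exprn_gt0. Qed.

Let a0 h k w : 0 <= a h k w.
Proof. by rewrite mulr_ge0// invr_ge0 ltW. Qed.

Let as1 h k w : a h k w * sigma k w ^+ 2 <= 1.
Proof.
by rewrite /a mulrAC mulVf ?gt_eqF// mul1r indicE.
Qed.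

Let ma h k : measurable_wrt (F k) (a h k).
Proof.
apply/(measurable_wrtP (sF k)); apply: measurable_funM.
  apply: measurable_funV; apply: measurable_funX.
  exact/(measurable_wrtP (sF k)).
rewrite (_ : (fun _ => _) = \1_[set w | enorm (X k w - x) <= h]); last first.
  by apply/funext => w; rewrite !indicE; congr (_%:R).
apply: measurable_indic; apply: (sub_measurable (sF k)).
exact: measurable_wrt_ball.
Qed.

Let kernel_weightE h w : kernel_weight x X sigma N h w = stopped_sum N (a h) w.
Proof. by rewrite /kernel_weight /stopped_sum big_add1. Qed.

Let kernel_sumE V h w : kernel_sum x X sigma N V h w =
  stopped_sum N (fun k w => a h k w * V k.+1 w) w.
Proof. by rewrite /kernel_sum /stopped_sum big_add1. Qed.

Definition kernel_noise h w := kernel_sum x X sigma N eps h w.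

Lemma kernel_weight_ge0 h w : 0 <= kernel_weight x X sigma N h w.
Proof. by rewrite kernel_weightE; apply: sumr_ge0. Qed.

Lemma kernel_weight_le h h' w : h <= h' ->
  kernel_weight x X sigma N h w <= kernel_weight x X sigma N h' w.
Proof.
move=> hh; rewrite !kernel_weightE; apply: ler_sum => k _.
apply: ler_wpM2l; first by rewrite invr_ge0 ltW.
rewrite !indicE ler_nat.
case: (boolP (X k w \in [set z | enorm (z - x) <= h])) => //.
by rewrite inE /= => xh; rewrite mem_set//=; exact: le_trans xh hh.
Qed.

Lemma measurable_kernel_weight h :
  measurable_fun [set: T] (kernel_weight x X sigma N h).
Proof.
have -> : kernel_weight x X sigma N h = stopped_sum N (a h).
  by apply/funext => w; exact: kernel_weightE.
by apply: (measurable_stopped_sum fF stN) => k; exact: sub (ma h k).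
Qed.

Lemma measurable_kernel_mean h :
  measurable_fun [set: T] (kernel_mean x X sigma N Y h).
Proof.
have -> : kernel_mean x X sigma N Y h = fun w =>
    (kernel_weight x X sigma N h w)^-1 *
    stopped_sum N (fun k w => a h k w * Y k.+1 w) w.
  by apply/funext => w; rewrite -kernel_sumE.
apply: measurable_funM.
  by apply: measurable_funV; exact: measurable_kernel_weight.
apply: (measurable_stopped_sum fF stN) => k; apply: measurable_funM.
  exact: sub (ma h k).
exact: (@sub _ _ k.+1 _ (mY _)).
Qed.

Lemma kernel_mean_noise h w :
  kernel_mean x X sigma N Y h w -
    kernel_mean x X sigma N (fun k w => f (X k.-1 w)) h w =
  (kernel_weight x X sigma N h w)^-1 * kernel_noise h w.
Proof.
rewrite /kernel_mean -mulrBr; congr (_ * _).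
rewrite /kernel_noise !kernel_sumE /stopped_sum -sumrB.
by apply: eq_bigr => k _; rewrite -mulrBr YE//= addrC addKr.
Qed.

(** [stopped_tail] for the errors and for their opposites. The weight times sigma^2 is an indicator,
    hence at most 1 as required there. *)
Lemma kernel_noise_tail h :
  tail_bound P ((1 + gamma) / mu) (kernel_weight x X sigma N h) (kernel_noise h) /\
  tail_bound P ((1 + gamma) / mu) (kernel_weight x X sigma N h)
    (fun w => - kernel_noise h w).
Proof.
have me k : measurable_wrt (F k.+1) (eps k.+1) by case: (meps (ltn0Sn k)).
have mnoise : measurable_fun [set: T] (kernel_noise h).
  have -> : kernel_noise h = stopped_sum N (fun k w => a h k w * eps k.+1 w).
    by apply/funext => w; rewrite -kernel_sumE.
  apply: (measurable_stopped_sum fF stN) => k.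
  by apply: measurable_funM; [exact: sub (ma h k)|exact: sub (me k)].
have mset (M : T -> R) lam y : measurable_fun [set: T] M ->
    measurable [set w | y <= lam * M w
      - (1 + gamma) / mu * lam ^+ 2 * kernel_weight x X sigma N h w].
  move=> mM; apply: measurable_ler => //; apply: measurable_funB.
    exact: measurable_funM.
  by apply: measurable_funM => //; exact: measurable_kernel_weight.
have ce k : centered_wrt P (F k) (eps k.+1).
  have [_ _ ce] := meps (ltn0Sn k).
  exact: (cond_exp0_centered (sF k) (@FT k) (sub (me k)) ce).
have ve k : exp_sqr_le_wrt P (F k) mu gamma (eps k.+1) (sigma k).
  have [Z cZ Zle] := sg (ltn0Sn k).
  exact: (cond_exp_exp_sqr_le (sF k) (@FT k) (ltW gamma0) (sub (me k))
    (msig k) cZ Zle).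
split=> lam y lam0 /=; split.
- exact: mset.
- have := stopped_tail fF mu0 gamma0 me msig sig0 ce ve
    stN (ma h) (a0 h) (as1 h) y lam0.
  under eq_set do rewrite -kernel_sumE -kernel_weightE.
  by [].
- by apply: mset; exact: measurable_funN.
- have meN k : measurable_wrt (F k.+1) (fun w => - eps k.+1 w).
    apply/(measurable_wrtP (sF k.+1)); apply: measurable_funN.
    exact/(measurable_wrtP (sF k.+1)).
  have := stopped_tail fF mu0 gamma0 meN msig sig0
    (fun k => centered_wrtN (ce k)) (fun k => exp_sqr_le_wrtN (ve k))
    stN (ma h) (a0 h) (as1 h) y lam0.
  have nE w : stopped_sum N (fun k w => a h k w * - eps k.+1 w) w =
      - kernel_noise h w.
    rewrite /kernel_noise kernel_sumE /stopped_sum -sumrN.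
    by apply: eq_bigr => k _; rewrite mulrN.
  under eq_set do rewrite nE -kernel_weightE.
  by [].
Qed.

End kernel_noise.

(** * Choice of constants and final rates *)

Lemma powR_exp (R : realType) (x y : R) : 0 < x -> x `^ y = expR (y * ln x).
Proof. by move=> x0; rewrite /powR gt_eqF. Qed.

Lemma scale_bw (R : realType) (h0 q alpha0 : R) : 0 < h0 -> 0 < q ->
  forall j, (h0 * q ^+ j / h0) `^ alpha0 = (q `^ alpha0) ^+ j.
Proof.
move=> h00 q0 j; rewrite [h0 * _]mulrC mulfK ?gt_eqF//.
by rewrite -(powR_mulrn j (ltW q0)) -(powR_mulrn j (powR_ge0 _ _)) -!powRrM mulrC.
Qed.

(** The summability condition of [noise_union_bound] at level (3 / 8) nu. In logarithms it reads
    alpha0 rho < (27 / 16) Q, and the range of [rho] gives alpha0 rho < Q. *)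
Lemma expR_decay_lt1 (R : realType) (mu gamma q b alpha0 nu rho : R) :
  0 < mu -> 0 < gamma -> 0 < q < 1 -> 0 < alpha0 ->
  rho < b * mu * nu ^+ 2 / (64 * alpha0 * (1 + gamma)) -> 0 < b -> 0 < nu ->
  expR (- (3 / 16 * (3 / 8 * nu) ^+ 2 / ((1 + gamma) / mu) * (b * - ln q))) *
    ((q `^ alpha0) `^ rho)^-1 < 1.
Proof.
move=> mu0 g0 /andP[q0 q1] al0 hr b0 nu0.
rewrite -powRrM powR_exp// -expRN -expRD expR_lt1.
have lq : 0 < - ln q by rewrite oppr_gt0 ln_lt0// q0.
have g1 : 0 < 1 + gamma by lra.
have hr' : alpha0 * rho < b * mu * nu ^+ 2 / (64 * (1 + gamma)).
  have -> : b * mu * nu ^+ 2 / (64 * (1 + gamma)) =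
      alpha0 * (b * mu * nu ^+ 2 / (64 * alpha0 * (1 + gamma))).
    by field; rewrite !gt_eqF.
  by rewrite ltr_pM2l.
set Q := b * mu * nu ^+ 2 / (64 * (1 + gamma)) in hr'.
have Q0 : 0 < Q by rewrite divr_gt0 ?mulr_gt0 ?exprn_gt0.
rewrite [X in X < _](_ : _ = (- ln q) * (alpha0 * rho - 27 / 16 * Q)).
  by rewrite pmulr_rlt0//; lra.
by rewrite /Q; field; rewrite !gt_eqF.
Qed.

Lemma large_time_bounds (R : realType) (A K nu s1 : R) :
  0 < A -> 1 <= K -> 0 < nu -> 0 < s1 ->
  exists2 t0, 0 < t0 & forall t, t0 <= t ->
    let s := A * Num.sqrt (ln (t + 1)) in
    [/\ 1 <= ln (t + 1), s1 <= s, s * K <= t - 1, s <= t - 1 - nu & s < t - 1] /\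
    2 <= t.
Proof.
move=> A0 K1 nu0 s10.
pose c1 := expR ((s1 / A) ^+ 2); pose c2 := (4 * (A * K)) ^+ 2.
have c10 : 0 < c1 := expR_gt0 _.
have c20 : 0 <= c2 := sqr_ge0 _.
have e0 : 0 < expR 1 :> R := expR_gt0 _.
(* [expR 1] makes the logarithm at least 1 and [c1] gives s >= s1. As ln (t + 1) <= t, [c2] gives s
   K <= t / 4; the terms 2 + 2 nu turn this into the remaining bounds. *)
exists (2 + 2 * nu + c1 + c2 + expR 1); first by lra.
move=> t tt s.
have t0 : 0 < t by lra.
have ln1 : 1 <= ln (t + 1).
  by rewrite -[leLHS]expRK ler_ln ?posrE//; lra.
have lns : (s1 / A) ^+ 2 <= ln (t + 1).
  by rewrite -[leLHS]expRK -/c1 ler_ln ?posrE//; lra.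
have s1s : s1 <= s.
  rewrite /s mulrC -ler_pdivrMr// -[leLHS]ger0_norm; last first.
    by rewrite divr_ge0// ltW.
  by rewrite -sqrtr_sqr ler_wsqrtr.
have sq : Num.sqrt (ln (t + 1)) <= Num.sqrt t.
  rewrite ler_wsqrtr// -ler_expR lnK ?posrE; last by lra.
  by rewrite addrC expR_ge1Dx.
have st : 4 * (A * K) <= Num.sqrt t.
  rewrite -[leLHS]ger0_norm ?mulr_ge0 ?(ltW A0)//; last by lra.
  by rewrite -sqrtr_sqr ler_wsqrtr// -/c2; lra.
have tsq : Num.sqrt t * Num.sqrt t = t by rewrite -expr2 sqr_sqrtr// ltW.
have sK : s * K <= t / 4.
  have h : s * K <= (A * K) * Num.sqrt t.
    rewrite /s mulrAC ler_wpM2l// mulr_ge0// ?ltW//; lra.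
  have sqt0 : 0 <= Num.sqrt t := sqrtr_ge0 _.
  by nra.
have s0 : 0 <= s by rewrite mulr_ge0 ?sqrtr_ge0 ?ltW.
have ssK : s <= s * K by rewrite ler_peMr.
by split; last lra; split=> //; lra.
Qed.

Section rates.
Context (R : realType) (t rho : R).
Hypotheses (t2 : 2 <= t) (ln1 : 1 <= ln (t + 1)) (rho0 : 0 < rho).
Let Z := ln (t + 1) `^ (1 + rho / 2) / t `^ rho.

Let t0 : 0 < t. Proof. exact: lt_le_trans t2. Qed.

Lemma expR_rate_le : expR (- (rho * ln (t + 1))) <= Z.
Proof.
have t00 := t0; have ln0 : 0 < ln (t + 1) by exact: lt_le_trans ln1.
have t10 : 0 < t + 1 by rewrite addr_gt0.
rewrite expRN -powR_exp//.
apply: (@le_trans _ _ (t `^ rho)^-1).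
  rewrite lef_pV2 ?posrE ?powR_gt0// ge0_ler_powR ?nnegrE ?(ltW rho0) ?ltW//.
  by rewrite ltrDl.
rewrite /Z ler_peMl ?invr_ge0 ?powR_ge0//.
apply: (@le_trans _ _ (1 `^ (1 + rho / 2))); first by rewrite powR1.
by rewrite ge0_ler_powR ?nnegrE ?(ltW ln0)// addr_ge0// divr_ge0// ltW.
Qed.

(** t - 1 >= t / 2 explains the factor 2; the square root of the logarithm contributes the power rho
    / 2, below 1 + rho / 2. *)
Lemma powR_rate_le (A u0 delta0 : R) : 0 < A -> 0 < u0 -> 0 < delta0 ->
  (A * Num.sqrt (ln (t + 1)) * u0 / (t - 1) / delta0) `^ rho <=
  (2 * A * u0 / delta0) `^ rho * Z.
Proof.
move=> A0 u00 d00; have t00 := t0.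
have ln0 : 0 < ln (t + 1) by exact: lt_le_trans ln1.
have t10 : 0 < t - 1 by rewrite subr_gt0 (lt_le_trans _ t2)// ltr1n.
have sq0 := sqrtr_ge0 (ln (t + 1)).
set s := A * Num.sqrt (ln (t + 1)).
have s0 : 0 < s by rewrite mulr_gt0// sqrtr_gt0.
have C0 : 0 <= 2 * A * u0 / delta0.
  by rewrite divr_ge0 ?mulr_ge0 ?(ltW A0) ?(ltW u00)// ltW.
have tV : (t^-1) `^ rho = (t `^ rho)^-1.
  by rewrite !powR_exp ?invr_gt0// lnV ?posrE// mulrN expRN.
have le1 : s * u0 / (t - 1) / delta0 <=
    (2 * A * u0 / delta0) * (Num.sqrt (ln (t + 1)) * t^-1).
  rewrite [leRHS](_ : _ = (s * u0 * (2 / t)) / delta0); last by rewrite /s; ring.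
  have su0 : 0 < s * u0 by exact: mulr_gt0.
  rewrite ler_pM2r ?invr_gt0// ler_pM2l//.
  by have t2' := t2; rewrite -[leLHS]mul1r ler_pdivrMr// mulrAC ler_pdivlMr//; lra.
have le2 : (s * u0 / (t - 1) / delta0) `^ rho <=
    ((2 * A * u0 / delta0) * (Num.sqrt (ln (t + 1)) * t^-1)) `^ rho.
  apply: (ge0_ler_powR (ltW rho0) _ _ le1).
    by rewrite nnegrE !divr_ge0 ?mulr_ge0 ?(ltW s0) ?(ltW u00) ?(ltW t10)// ltW.
  by rewrite nnegrE mulr_ge0// mulr_ge0// invr_ge0 ltW.
apply: (le_trans le2).
have tV0 : 0 <= t^-1 by rewrite invr_ge0 ltW.
rewrite (powRM _ C0 (mulr_ge0 sq0 tV0)) ler_wpM2l ?powR_ge0//.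
rewrite (powRM _ sq0 tV0) tV /Z ler_wpM2r ?invr_ge0 ?powR_ge0//.
rewrite -powR12_sqrt ?(ltW ln0)// -powRrM ler_powR//.
by have r0 := rho0; lra.
Qed.

End rates.

Theorem theorem1 (R : realType)
  (mu gamma q b u0 delta0 alpha0 nu rho : R)
  (mu_gt0 : 0 < mu) (gamma_gt0 : 0 < gamma) (q01 : 0 < q < 1)
  (b_gt0 : 0 < b) (u0_gt0 : 0 < u0) (delta0_gt0 : 0 < delta0)
  (alpha0_gt0 : 0 < alpha0) (nu_gt0 : 0 < nu)
  (rho_range : 0 < rho < b * mu * nu ^+ 2 / (64 * alpha0 * (1 + gamma))) :
  exists C0 t0 : R, [/\ 0 < C0, 0 < t0 &
  forall (d : nat) (x : 'rV[R]_d) (f : 'rV[R]_d -> R) (h0 : R)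
    (disp : measure_display) (T : measurableType disp) (P : probability T R)
    (F : nat -> set (set T)) (X : nat -> T -> 'rV[R]_d)
    (Y eps sigma : nat -> T -> R) (N : T -> nat) (W : R -> T -> R),
  let L h w := kernel_weight x X sigma N h w in
  let fhat h w := kernel_mean x X sigma N Y h w in
  let ftilde h w :=
    kernel_mean x X sigma N (fun k w' => f (X k.-1 w')) h w in
  let HH w := bandwidths h0 q (L ^~ w) in
  let Hu0 w := H_ h0 q b (L ^~ w) u0 in
  let Hhat w := hatH h0 q b u0 nu (L ^~ w) (fhat ^~ w) in
  let Wbar h w := barW h0 u0 delta0 alpha0 (W ^~ w) h in
  let Hst w := Hstar h0 q b (L ^~ w) (Wbar ^~ w) in
  let Omega' :=
    [set w | rsqrt_le (L h0 w) (Wbar h0 w) /\ W (Hst w) w <= u0] in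
  0 < h0 ->
  filtration F ->
  (forall k, vmeasurable_wrt (F k) (X k)) ->
  (forall k, (1 <= k)%N -> measurable_wrt (F k) (Y k)) ->
  (forall k w, (1 <= k)%N -> Y k w = f (X k.-1 w) + eps k w) ->
  martingale_increment P F eps ->
  stopping_time F N ->
  (forall w, (1 <= N w)%N) ->
  (forall k, measurable_wrt (F k) (sigma k)) ->
  (forall k w, 0 < sigma k w) ->
  sub_gaussian P F eps sigma mu gamma ->
  (forall j : nat, let h := h0 * q ^+ j in
    measurable_fun [set w | HH w h] (W h)) ->
  (forall w h, HH w h -> 0 <= W h w) ->
  (forall w, rsqrt_le (L h0 w) u0 -> forall h, HH w h ->
    (ereal_sup [set `|ftilde h' w - f x|%:E |
        h' in [set h' | HH w h' /\ (Hu0 w <= h' <= h)%R]] <= (W h w)%:E)%E) ->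
  forall t : R, t0 <= t ->
    (P ([set w | (t * Wbar (Hst w) w <= `|fhat (Hhat w) w - f x|)%R]
          `&` Omega')
      <= (C0 * (ln (t + 1) `^ (1 + rho / 2) / t `^ rho))%:E)%E].
Proof.
have /andP[q0 q1] := q01; have /andP[rho0 rhob] := rho_range.
pose c := (1 + gamma) / mu.
have c0 : 0 < c by rewrite divr_gt0//; lra.
pose p := q `^ alpha0.
have p0 : 0 < p by rewrite powR_gt0.
have p1 : p < 1.
  by rewrite /p powR_exp// expR_lt1 pmulr_rlt0// ln_lt0// q0.
have lq : 0 < - ln q by rewrite oppr_gt0 ln_lt0// q0.
(* Noise level of the rejection case in [lepski_cases]. *)
pose s1 := 3 / 8 * nu; have s10 : 0 < s1 by rewrite /s1; lra.
have bq0 : 0 < b * - ln q by rewrite mulr_gt0.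
have p01 : 0 < p < 1 by rewrite p0.
have [S S0 HS] := noise_union_bound c0 u0_gt0 delta0_gt0 p01 bq0 s10 rho0
  (expR_decay_lt1 mu_gt0 gamma_gt0 q01 alpha0_gt0 rhob b_gt0 nu_gt0).
(* Chosen so that s = A sqrt(ln (t + 1)) gives 3 s^2 / (16 c) = rho ln (t + 1). *)
pose A := Num.sqrt (16 * rho * c / 3).
have A0 : 0 < A by rewrite sqrtr_gt0 divr_gt0// mulr_gt0// mulr_gt0.
have A2 : 3 / 16 * A ^+ 2 / c = rho.
  rewrite sqr_sqrtr; first by field; rewrite gt_eqF.
  by move: A0; rewrite sqrtr_gt0 => /ltW.
pose K := 1 + 8 / nu.
have K1 : 1 <= K by rewrite lerDl divr_ge0// ltW.
have [t0 t00 Ht0] := large_time_bounds A0 K1 nu_gt0 s10.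
pose B := (2 * A * u0 / delta0) `^ rho.
exists (S * (1 + B)), t0; split=> //.
  by rewrite mulr_gt0// ltr_wpDr// powR_ge0.
move=> d x f h0 disp T P F X Y eps sigma N W L fhat ftilde HH Hu0 Hhat Wbar Hst
  Omega' h00 fF mX mY YE meps stN N1 msig sig0 sg mW W0 bias t t0t.
have [[ln1 s1s sK snu st] t2] := Ht0 _ t0t.
set s := A * Num.sqrt (ln (t + 1)) in s1s sK snu st.
have s0 : 0 < s by exact: lt_le_trans s1s.
have L0 w h : 0 <= L h w by exact: kernel_weight_ge0.
have Lmon w h h' : h <= h' -> L h w <= L h' w by exact: kernel_weight_le.
pose M h w := kernel_noise x X eps sigma N h w.
have tails h := kernel_noise_tail x mu_gt0 gamma_gt0 fF mX meps stN msig sig0 sg h.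
have t1 : 0 < t - 1 by rewrite subr_gt0 (lt_le_trans _ t2)// ltr1n.
pose tau := s * u0 / (t - 1).
have tau0 : 0 < tau by apply: divr_gt0 => //; exact: mulr_gt0.
have HS' := HS _ _ P (fun j => L (h0 * q ^+ j)) (fun j => M (h0 * q ^+ j))
  (fun j => (tails _).1) (fun j => (tails _).2).
(* With [delta0] in place of [tau] the scale constraint always holds, so [U1] covers all bandwidths
   at level [s]; [U2] covers those of scale at most [tau] at level [s1]. *)
have [U1 [mU1 PU1] HU1] := HS' s delta0 s1s delta0_gt0.
have [U2 [mU2 PU2] HU2] := HS' s1 tau (lexx _) tau0.
set E := _ `&` _.
have mE : measurable E.
  apply: (measurable_lepski_event u0 delta0 alpha0 h00 q01 b_gt0 nu_gt0 L0 Lmon).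
  - by move=> j; exact: (measurable_kernel_weight x fF mX stN msig).
  - by move=> j; exact: (measurable_kernel_mean x fF mX mY stN msig).
  - move=> j; rewrite (_ : [set w | _] = [set w | HH w (h0 * q ^+ j)]).
      exact: mW.
    by apply/seteqP; split=> w /=; [exists j|case].
have scaleE := scale_bw alpha0 h00 q0.
have EU : E `<=` U1 `|` U2.
  move=> w [/= err [start WHst]].
  (* The bias assumption is stated where L(h0)^(-1/2) <= u0, which contains the event since Wbar <=
     u0. *)
  have startu : rsqrt_le (L h0 w) u0.
    by case: start => l0 l1; split=> //; apply: (le_trans l1); exact: barW_le.
  have bias' h h' : HH w h -> HH w h' -> Hu0 w <= h' <= h ->
      `|ftilde h' w - f x| <= W h w.
    move=> Hh Hh' h'h; rewrite -lee_fin (le_trans _ (bias w startu h Hh))//.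
    by apply: ereal_sup_ubound; exists h'.
  have large cc h : large_noise h0 q b (L ^~ w) u0 delta0 alpha0
        (fhat ^~ w) (ftilde ^~ w) cc h ->
      exists j, [/\ h = h0 * q ^+ j, 0 < L (h0 * q ^+ j) w,
        Num.sqrt ((1 + b * - ln q * j%:R) / L (h0 * q ^+ j) w) <= u0 &
        cc * Num.max (Num.sqrt ((1 + b * - ln q * j%:R) / L (h0 * q ^+ j) w))
          (Num.min (delta0 * p ^+ j) u0) <=
          `|(L (h0 * q ^+ j) w)^-1 * M (h0 * q ^+ j) w|].
    move=> [[j -> Lj]]; rewrite /rate (psi_bw _ h00 q01) /threshold scaleE.
    rewrite (kernel_mean_noise x sigma N YE) => ru sM; by exists j.
  have [[h]|[h]] := lepski_cases (W := W ^~ w) (fhat := fhat ^~ w)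
    (ftil := ftilde ^~ w) h00 q01 b_gt0 (L0 w) (@Lmon w) u0_gt0 delta0_gt0
    alpha0_gt0 nu_gt0 start bias' WHst err (ltW s0) sK snu st.
    move=> /large[j [_ Lj ru sM]]; left; apply: (HU1 w j Lj ru sM).
    by rewrite ler_piMr ?(ltW delta0_gt0)// exprn_ile1// ltW.
  move=> /large[j [-> Lj ru sM]]; rewrite scaleE => htau.
  by right; exact: (HU2 w j Lj ru sM).
have t10 : 0 < t by exact: lt_le_trans t2.
apply: (@le_trans _ _ (P (U1 `|` U2))).
  by rewrite le_measure ?inE//; exact: measurableU.
apply: (le_trans (measureU2 _ mU1 mU2)).
apply: (le_trans (leeD PU1 PU2)); rewrite -EFinD lee_fin.
have lnt0 : 0 < ln (t + 1) by exact: lt_le_trans ln1.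
set Z := ln (t + 1) `^ (1 + rho / 2) / t `^ rho.
have b1 : expR (- (3 / 16 * s ^+ 2 / c)) <= Z.
  have -> : 3 / 16 * s ^+ 2 / c = rho * ln (t + 1).
    by rewrite -A2 /s exprMn [Num.sqrt (ln _) ^+ 2]sqr_sqrtr ?(ltW lnt0)//; ring.
  exact: expR_rate_le.
have b2 : (tau / delta0) `^ rho <= B * Z by exact: powR_rate_le.
have e1 : expR (- (3 / 16 * s1 ^+ 2 / c)) <= 1.
  by rewrite expR_le1 oppr_le0 divr_ge0 ?(ltW c0)// mulr_ge0// sqr_ge0.
rewrite divff ?gt_eqF// powR1 mulr1.
have b3 : expR (- (3 / 16 * s1 ^+ 2 / c)) * (tau / delta0) `^ rho <= B * Z.
  by apply: le_trans b2; rewrite ler_piMl ?powR_ge0.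
rewrite -/Z [leRHS](_ : _ = S * Z + S * (B * Z)); last by ring.
apply: lerD; first by rewrite ler_wpM2l// ltW.
by rewrite -mulrA ler_wpM2l// ltW.
Qed.
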